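(* Let $0<q<1$, let $m,n\ge 1$ and $N=m+n$. Let $D(\mathbb U)_q$ be the algebra of finite functions on the quantum matrix ball, $\mathcal H=\mathbb C[\mathrm{Mat}_{mn}]_q\cdot f_0\subset D(\mathbb U)_q$, $\Theta$ the representation of $D(\mathbb U)_q$ in $\mathcal H$ by left multiplication, and $\Gamma$ the representation of $U_q\mathfrak p_+$ in $\mathcal H$. Then the linear functional $$\nu:D(\mathbb U)_q\to\mathbb C,\qquad \int_{\mathbb U_q}f\,d\nu\stackrel{\rm def}{=}\mathrm{tr}\bigl(\Theta(f)\,\Gamma(e^{h\check\rho})\bigr)$$ is well defined, $U_q\mathfrak{sl}_N$-invariant (that is, $\int_{\mathbb U_q}(\xi f)\,d\nu=\varepsilon(\xi)\int_{\mathbb U_q}f\,d\nu$ for all $\xi\in U_q\mathfrak{sl}_N$, $f\in D(\mathbb U)_q$), and positive, in the sense that $\int_{\mathbb U_q}f\,d\nu>0$ for all non-zero non-negative elements $f$ of the $*$-algebra $D(\mathbb U)_q$.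
   Context: The ground field is $\mathbb C$, $0<q<1$, $m,n\ge1$, $N=m+n$, and $(a_{ij})_{i,j=1}^{N-1}$ is the Cartan matrix $a_{ii}=2$, $a_{ij}=-1$ for $|i-j|=1$, $a_{ij}=0$ otherwise. **The Hopf $*$-algebra.** $U_q\mathfrak{sl}_N$ is the Hopf algebra with generators $E_i,F_i,K_i^{\pm1}$ ($1\le i\le N-1$) and relations $K_iK_j=K_jK_i$, $K_iK_i^{-1}=K_i^{-1}K_i=1$, $K_iE_j=q^{a_{ij}}E_jK_i$, $K_iF_j=q^{-a_{ij}}F_jK_i$, $E_iF_j-F_jE_i=\delta_{ij}(K_i-K_i^{-1})/(q-q^{-1})$, $E_i^2E_j-(q+q^{-1})E_iE_jE_i+E_jE_i^2=0$ and $F_i^2F_j-(q+q^{-1})F_iF_jF_i+F_jF_i^2=0$ for $|i-j|=1$, $[E_i,E_j]=[F_i,F_j]=0$ for $|i-j|\ne1$; $\Delta(E_i)=E_i\otimes1+K_i\otimes E_i$, $\Delta(F_i)=F_i\otimes K_i^{-1}+1\otimes F_i$, $\Delta(K_i)=K_i\otimes K_i$; $S(E_i)=-K_i^{-1}E_i$, $S(F_i)=-F_iK_i$, $S(K_i)=K_i^{-1}$; $\varepsilon(E_i)=\varepsilon(F_i)=0$, $\varepsilon(K_i)=1$. $U_q\mathfrak{su}_{nm}$ is $U_q\mathfrak{sl}_N$ with the antilinear involution $(K_j^{\pm1})^*=K_j^{\pm1}$, $E_j^*=K_jF_j$, $F_j^*=E_jK_j^{-1}$ for $j\ne n$, $E_n^*=-K_nF_n$,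 $F_n^*=-E_nK_n^{-1}$. A covariant $*$-algebra is a $*$-algebra $F$ which is a $U_q\mathfrak{sl}_N$-module algebra with $(\xi f)^*=(S(\xi))^*f^*$ for $\xi\in U_q\mathfrak{su}_{nm}$, $f\in F$. **$\mathrm{Pol}(\mathrm{Mat}_{mn})_q$.** This is the unital $*$-algebra generated by $z_a^\alpha$ ($1\le a\le n$, $1\le\alpha\le m$) with relations: $z_{a_1}^{\alpha_1}z_{a_2}^{\alpha_2}=q z_{a_2}^{\alpha_2}z_{a_1}^{\alpha_1}$ if ($a_1=a_2$, $\alpha_1<\alpha_2$) or ($a_1<a_2$, $\alpha_1=\alpha_2$); $z_{a_1}^{\alpha_1}z_{a_2}^{\alpha_2}=z_{a_2}^{\alpha_2}z_{a_1}^{\alpha_1}$ if $\alpha_1<\alpha_2$, $a_1>a_2$; $z_{a_1}^{\alpha_1}z_{a_2}^{\alpha_2}-z_{a_2}^{\alpha_2}z_{a_1}^{\alpha_1}=(q-q^{-1})z_{a_1}^{\alpha_2}z_{a_2}^{\alpha_1}$ if $\alpha_1<\alpha_2$, $a_1<a_2$; and $(z_b^\beta)^*z_a^\alpha=q^2\sum_{a',b'=1}^n\sum_{\alpha',\beta'=1}^m r(b,a,b',a')\,r(\beta,\alpha,\beta',\alpha')\,z_{a'}^{\alpha'}(z_{b'}^{\beta'})^*+(1-q^2)\delta_{ab}\delta^{\alpha\beta}$, where $r(b,a,b',a')=q^{-1}$ if $a\ne b$, $b=b'$, $a=a'$; $=1$ if $a=b=a'=b'$; $=-(q^{-2}-1)$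 if $a=b$, $a'=b'$, $a'>a$; $=0$ otherwise. $\mathbb C[\mathrm{Mat}_{mn}]_q$ is the subalgebra generated by the $z_a^\alpha$. It is a covariant $*$-algebra with the action determined by: for $j<n$, $K_jz_j^\alpha=qz_j^\alpha$, $K_jz_{j+1}^\alpha=q^{-1}z_{j+1}^\alpha$, $K_jz_a^\alpha=z_a^\alpha$ for $a\notin\{j,j+1\}$, $E_jz_{j+1}^\alpha=q^{-1/2}z_j^\alpha$, $E_jz_a^\alpha=0$ for $a\neq j+1$, $F_jz_j^\alpha=q^{1/2}z_{j+1}^\alpha$, $F_jz_a^\alpha=0$ for $a\ne j$; for $j=n+i$, $1\le i\le m-1$, $K_jz_a^{m-i}=qz_a^{m-i}$, $K_jz_a^{m-i+1}=q^{-1}z_a^{m-i+1}$, $K_jz_a^\alpha=z_a^\alpha$ for other $\alpha$, $E_jz_a^{m-i+1}=q^{-1/2}z_a^{m-i}$ and $E_jz_a^\alpha=0$ for other $\alpha$, $F_jz_a^{m-i}=q^{1/2}z_a^{m-i+1}$ and $F_jz_a^\alpha=0$ for other $\alpha$; finally $K_nz_n^m=q^2z_n^m$, $K_nz_a^\alpha=qz_a^\alpha$ if exactly one of $a=n$, $\alpha=m$ holds, $K_nz_a^\alpha=z_a^\alpha$ if $a\ne n$, $\alpha\ne m$; $F_nz_a^\alpha=q^{1/2}\delta_{an}\delta_{\alpha m}$; $E_nz_n^m=-q^{1/2}(z_n^m)^2$, $E_nz_a^\alpha=-q^{-1/2}z_a^mz_n^\alpha$ if $a\ne n$, $\alpha\ne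 m$, $E_nz_a^\alpha=-q^{1/2}z_n^mz_a^\alpha$ otherwise. **Finite functions.** $\mathrm{Fun}(\mathbb U)_q$ is the covariant $*$-algebra obtained from $\mathrm{Pol}(\mathrm{Mat}_{mn})_q$ by adding a generator $f_0$ with relations $f_0=f_0^2=f_0^*$, $(z_a^\alpha)^*f_0=f_0z_a^\alpha=0$ for all $a,\alpha$, and the action $K_n^{\pm1}f_0=f_0$, $E_nf_0=-\frac{q^{1/2}}{1-q^2}z_n^mf_0$, $F_nf_0=-\frac{q^{1/2}}{q^{-2}-1}f_0(z_n^m)^*$, $(K_j^{\pm1}-1)f_0=E_jf_0=F_jf_0=0$ for $j\ne n$. $D(\mathbb U)_q$ is the two-sided ideal of $\mathrm{Fun}(\mathbb U)_q$ generated by $f_0$; it is a covariant $*$-algebra. $\mathcal H=\mathbb C[\mathrm{Mat}_{mn}]_q f_0\subset D(\mathbb U)_q$, and $\Theta(\psi)f=\psi f$ for $\psi\in\mathrm{Fun}(\mathbb U)_q$, $f\in\mathcal H$. $U_q\mathfrak p_+\subset U_q\mathfrak{sl}_N$ is the Hopf subalgebra generated by $K_n^{\pm1},E_n$ and $K_j^{\pm1},E_j,F_j$, $j\ne n$; $\mathcal H$ is a $U_q\mathfrak p_+$-submodule of $D(\mathbb U)_q$ and $\Gamma$ is the corresponding representation. **The element $e^{h\check\rho}$.** Here $q=e^{-h/2}$, $K_i=e^{-hH_i/2}$, the Cartan subalgebra spanned by $H_1,\dots,H_{N-1}$ has the scalar product $(H_i,H_j)=a_{ij}$, and $\check\rho$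 is determined by $(\check\rho,H_i)=1$ for all $i$. Thus $\check\rho=\frac12\sum_i i(N-i)H_i$ and $e^{h\check\rho}=\prod_iK_i^{-i(N-i)}$. **Conventions.** ''Well defined'' means that the trace makes sense (the operators $\Theta(f)$, $f\in D(\mathbb U)_q$, have finite rank). An element of a $*$-algebra is non-negative if it is a finite sum of elements $g^*g$. *)

(* Defs.v *)
From HB Require Import structures.
From mathcomp Require Import all_boot all_order all_algebra.
From mathcomp Require Import ring complex boolp classical_sets reals.

Set Implicit Arguments.
Unset Strict Implicit.
Unset Printing Implicit Defensive.

Import Order.TTheory GRing.Theory Num.Theory.
Local Open Scope ring_scope.

Section Presented.
Variables (K : comNzRingType) (X : Type).

(* [Cst c] stands for the scalar [c] times the unit. *)
Inductive term : Type :=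
  | Gen of X
  | Cst of K
  | Add of term & term
  | Mul of term & term.

HB.instance Definition _ := gen_eqMixin term.
HB.instance Definition _ := gen_choiceMixin term.

Variable rel : term -> term -> Prop.

Inductive cong : term -> term -> Prop :=
  | cong_rel t u : rel t u -> cong t u
  | cong_refl t : cong t t
  | cong_sym t u : cong t u -> cong u t
  | cong_trans t u v : cong t u -> cong u v -> cong t v
  | cong_add t t' u u' : cong t t' -> cong u u' -> cong (Add t u) (Add t' u')
  | cong_mul t t' u u' : cong t t' -> cong u u' -> cong (Mul t u) (Mul t' u')
  | cong_addA t u v : cong (Add t (Add u v)) (Add (Add t u) v)
  | cong_addC t u : cong (Add t u) (Add u t)
  | cong_add0 t : cong (Add (Cst 0) t) t
  | cong_addN t : cong (Add (Mul (Cst (-1)) t) t) (Cst 0)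
  | cong_mulA t u v : cong (Mul t (Mul u v)) (Mul (Mul t u) v)
  | cong_mul1 t : cong (Mul (Cst 1) t) t
  | cong_mulDl t u v : cong (Mul (Add t u) v) (Add (Mul t v) (Mul u v))
  | cong_mulDr t u v : cong (Mul t (Add u v)) (Add (Mul t u) (Mul t v))
  | cong_cstD a b : cong (Cst (a + b)) (Add (Cst a) (Cst b))
  | cong_cstM a b : cong (Cst (a * b)) (Mul (Cst a) (Cst b))
  | cong_cstC a t : cong (Mul (Cst a) t) (Mul t (Cst a)).

Definition congb (t u : term) : bool := `[< cong t u >].

Lemma congb_refl : reflexive congb.
Proof. by move=> t; apply/asboolP; exact: cong_refl. Qed.

Lemma congb_sym : symmetric congb.
Proof. by move=> t u; apply/asboolP/asboolP; exact: cong_sym. Qed.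

Lemma congb_trans : transitive congb.
Proof.
by move=> u t v /asboolP tu /asboolP uv; apply/asboolP; exact: cong_trans uv.
Qed.

Canonical congb_equiv := EquivRel congb congb_refl congb_sym congb_trans.

Definition palg : Type := {eq_quot congb}%qT.

HB.instance Definition _ := Choice.on palg.
HB.instance Definition _ := EqQuotient.on palg.

Definition class_of (t : term) : palg := \pi_palg%qT t.

Lemma class_ofP t u : class_of t = class_of u <-> cong t u.
Proof.
split=> [tu|tu].
  by apply/asboolP; move/eqmodP: tu.
by apply/eqmodP; apply/asboolP.
Qed.

Lemma class_of_repr x : class_of (repr x) = x.
Proof. exact: reprK. Qed.

Lemma repr_class_of t : cong (repr (class_of t)) t.
Proof. by apply/class_ofP; rewrite class_of_repr. Qed.

Lemma palg_ind (P : palg -> Prop) : (forall t, P (class_of t)) -> forall x, P x.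
Proof. by move=> Pc x; rewrite -(class_of_repr x). Qed.

Definition palg_zero : palg := class_of (Cst 0).
Definition palg_one : palg := class_of (Cst 1).
Definition palg_add (x y : palg) : palg := class_of (Add (repr x) (repr y)).
Definition palg_mul (x y : palg) : palg := class_of (Mul (repr x) (repr y)).
Definition palg_scale (c : K) (x : palg) : palg :=
  class_of (Mul (Cst c) (repr x)).
Definition palg_opp (x : palg) : palg := palg_scale (-1) x.

Lemma palg_addE t u : palg_add (class_of t) (class_of u) = class_of (Add t u).
Proof. by apply/class_ofP; apply: cong_add; exact: repr_class_of. Qed.

Lemma palg_mulE t u : palg_mul (class_of t) (class_of u) = class_of (Mul t u).
Proof. by apply/class_ofP; apply: cong_mul; exact: repr_class_of. Qed.

Lemma palg_scaleE c t : palg_scale c (class_of t) = class_of (Mul (Cst c) t).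
Proof.
by apply/class_ofP; apply: cong_mul; [exact: cong_refl|exact: repr_class_of].
Qed.

Definition palgE := (palg_addE, palg_mulE, palg_scaleE).

Lemma palg_addA : associative palg_add.
Proof.
elim/palg_ind=> t; elim/palg_ind=> u; elim/palg_ind=> v.
by rewrite !palgE; apply/class_ofP; exact: cong_addA.
Qed.

Lemma palg_addC : commutative palg_add.
Proof.
elim/palg_ind=> t; elim/palg_ind=> u.
by rewrite !palgE; apply/class_ofP; exact: cong_addC.
Qed.

Lemma palg_add0 : left_id palg_zero palg_add.
Proof.
by elim/palg_ind=> t; rewrite !palgE; apply/class_ofP; exact: cong_add0.
Qed.

Lemma palg_addN : left_inverse palg_zero palg_opp palg_add.
Proof.
elim/palg_ind=> t.
by rewrite /palg_opp !palgE; apply/class_ofP; exact: cong_addN.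
Qed.

HB.instance Definition _ :=
  GRing.isZmodule.Build palg palg_addA palg_addC palg_add0 palg_addN.

Lemma palg_mulA : associative palg_mul.
Proof.
elim/palg_ind=> t; elim/palg_ind=> u; elim/palg_ind=> v.
by rewrite !palgE; apply/class_ofP; exact: cong_mulA.
Qed.

Lemma palg_mul1 : left_id palg_one palg_mul.
Proof.
by elim/palg_ind=> t; rewrite !palgE; apply/class_ofP; exact: cong_mul1.
Qed.

Lemma palg_mulr1 : right_id palg_one palg_mul.
Proof.
elim/palg_ind=> t; rewrite !palgE; apply/class_ofP.
by apply: cong_trans (cong_mul1 t); apply: cong_sym; exact: cong_cstC.
Qed.

Lemma palg_mulDl : left_distributive palg_mul palg_add.
Proof.
elim/palg_ind=> t; elim/palg_ind=> u; elim/palg_ind=> v.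
by rewrite !palgE; apply/class_ofP; exact: cong_mulDl.
Qed.

Lemma palg_mulDr : right_distributive palg_mul palg_add.
Proof.
elim/palg_ind=> t; elim/palg_ind=> u; elim/palg_ind=> v.
by rewrite !palgE; apply/class_ofP; exact: cong_mulDr.
Qed.

(* [algType] bundles non-triviality of the ring, which is not a formal
   consequence of a presentation; presented algebras are therefore equipped
   with the [pzRingType] and [lmodType] structures, the compatibility of the two
   being [palg_scaleAl] and [palg_scaleAr]. *)
HB.instance Definition _ :=
  GRing.Zmodule_isPzRing.Build palg palg_mulA palg_mul1 palg_mulr1
    palg_mulDl palg_mulDr.

Lemma palg_scaleA a b x : palg_scale a (palg_scale b x) = palg_scale (a * b) x.
Proof.
elim/palg_ind: x => t; rewrite !palgE; apply/class_ofP.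
apply: cong_trans (cong_mulA _ _ _) _.
by apply: cong_mul; [apply: cong_sym; exact: cong_cstM|exact: cong_refl].
Qed.

Lemma palg_scale1 : left_id 1 palg_scale.
Proof.
by elim/palg_ind=> t; rewrite !palgE; apply/class_ofP; exact: cong_mul1.
Qed.

Lemma palg_scaleDr : right_distributive palg_scale +%R.
Proof.
move=> c; elim/palg_ind=> t; elim/palg_ind=> u.
rewrite /GRing.add /= !palgE; apply/class_ofP; exact: cong_mulDr.
Qed.

Lemma palg_scaleDl x : {morph palg_scale^~ x : a b / a + b}.
Proof.
move=> a b; elim/palg_ind: x => t.
rewrite [in RHS]/GRing.add /= !palgE; apply/class_ofP.
apply: cong_trans (cong_mulDl _ _ _).
by apply: cong_mul; [exact: cong_cstD|exact: cong_refl].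
Qed.

HB.instance Definition _ :=
  GRing.Zmodule_isLmodule.Build K palg palg_scaleA palg_scale1 palg_scaleDr
    palg_scaleDl.

Lemma class_of0 : class_of (Cst 0) = 0. Proof. by []. Qed.
Lemma class_of1 : class_of (Cst 1) = 1. Proof. by []. Qed.

Lemma class_ofD t u : class_of (Add t u) = class_of t + class_of u.
Proof. by rewrite -palg_addE. Qed.

Lemma class_ofM t u : class_of (Mul t u) = class_of t * class_of u.
Proof. by rewrite -palg_mulE. Qed.

Lemma palg_scaleAl (c : K) (x y : palg) : c *: (x * y) = (c *: x) * y.
Proof.
elim/palg_ind: x => t; elim/palg_ind: y => u.
rewrite /GRing.mul /GRing.scale /= !palgE; apply/class_ofP; exact: cong_mulA.
Qed.

Lemma class_ofC c : class_of (Cst c) = c *: (1 : palg).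
Proof.
apply: etrans (esym (palg_scaleE c (Cst 1))); apply/class_ofP.
apply: cong_sym; apply: cong_trans (cong_cstC _ _) _; exact: cong_mul1.
Qed.

Lemma palg_scaleAr (c : K) (x y : palg) : c *: (x * y) = x * (c *: y).
Proof.
elim/palg_ind: x => t; elim/palg_ind: y => u.
rewrite /GRing.mul /GRing.scale /= !palgE; apply/class_ofP.
apply: cong_trans (cong_mulA _ _ _) _.
apply: cong_trans; last by apply: cong_sym; exact: cong_mulA.
by apply: cong_mul; [exact: cong_cstC|exact: cong_refl].
Qed.

Lemma class_ofZ c t : class_of (Mul (Cst c) t) = c *: class_of t.
Proof. by rewrite class_ofM class_ofC -palg_scaleAl mul1r. Qed.

Lemma class_ofZr c t : class_of (Mul t (Cst c)) = c *: class_of t.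
Proof. by rewrite class_ofM class_ofC -palg_scaleAr mulr1. Qed.

(* Evaluation in the ground ring. *)
Fixpoint teval (g : X -> K) (t : term) : K :=
  match t with
  | Gen x => g x
  | Cst c => c
  | Add t u => teval g t + teval g u
  | Mul t u => teval g t * teval g u
  end.

Lemma teval_cong g :
  (forall t u, rel t u -> teval g t = teval g u) ->
  forall t u, cong t u -> teval g t = teval g u.
Proof.
move=> grel t u; elim=> //=.
- by move=> ? ? ? _ -> _ ->.
- by move=> ? ? ? ? _ -> _ ->.
- by move=> ? ? ? ? _ -> _ ->.
- by move=> *; rewrite addrA.
- by move=> *; rewrite addrC.
- by move=> *; rewrite add0r.
- by move=> *; rewrite mulN1r addNr.
- by move=> *; rewrite mulrA.
- by move=> *; rewrite mul1r.
- by move=> *; rewrite mulrDl.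
- by move=> *; rewrite mulrDr.
- by move=> *; rewrite mulrC.
Qed.

(* The anti-endomorphism, semilinear with respect to [s], which takes the
   generator [x] to [g x]. *)
Fixpoint tanti (s : K -> K) (g : X -> term) (t : term) : term :=
  match t with
  | Gen x => g x
  | Cst c => Cst (s c)
  | Add t u => Add (tanti s g t) (tanti s g u)
  | Mul t u => Mul (tanti s g u) (tanti s g t)
  end.

Lemma tanti_cong (s : {rmorphism K -> K}) g :
  (forall t u, rel t u -> cong (tanti s g t) (tanti s g u)) ->
  forall t u, cong t u -> cong (tanti s g t) (tanti s g u).
Proof.
move=> grel t u; elim=> //=.
- by move=> *; exact: cong_refl.
- by move=> *; exact: cong_sym.
- by move=> *; apply: cong_trans; eassumption.
- by move=> *; exact: cong_add.
- by move=> *; exact: cong_mul.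
- by move=> *; exact: cong_addA.
- by move=> *; exact: cong_addC.
- by move=> *; rewrite rmorph0; exact: cong_add0.
- move=> v; rewrite rmorph0 rmorphN rmorph1.
  apply: cong_trans (cong_addN (tanti s g v)).
  by apply: cong_add; [apply: cong_sym; exact: cong_cstC|exact: cong_refl].
- by move=> *; apply: cong_sym; exact: cong_mulA.
- move=> v; rewrite rmorph1.
  by apply: cong_trans (cong_mul1 _); apply: cong_sym; exact: cong_cstC.
- by move=> *; exact: cong_mulDr.
- by move=> *; exact: cong_mulDl.
- by move=> a b; rewrite rmorphD; exact: cong_cstD.
- move=> a b; rewrite rmorphM; apply: cong_trans (cong_cstM _ _) _.
  exact: cong_cstC.
- by move=> a v; apply: cong_sym; exact: cong_cstC.
Qed.

(* Meaningful when [tanti s g] respects the relations. *)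
Definition palg_anti (s : K -> K) (g : X -> term) (x : palg) : palg :=
  class_of (tanti s g (repr x)).

Lemma palg_antiE (s : {rmorphism K -> K}) g :
  (forall t u, rel t u -> class_of (tanti s g t) = class_of (tanti s g u)) ->
  forall t, palg_anti s g (class_of t) = class_of (tanti s g t).
Proof.
move=> grel t; apply/class_ofP.
apply: tanti_cong; last exact: repr_class_of.
by move=> v w /grel /class_ofP.
Qed.

End Presented.

Arguments Gen {K X}.
Arguments Cst {K X}.

Section StarPresented.
Variables (K : numClosedFieldType) (X : Type).

(* The generator [x] is [(x, false)], and [(x, true)] is its adjoint. *)
Definition sterm : Type := term K (X * bool).

Definition adj_gen (x : X * bool) : sterm := Gen (x.1, ~~ x.2).

Definition tadj : sterm -> sterm := tanti Num.conj adj_gen.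

Variable rel : sterm -> sterm -> Prop.

Inductive star_rel : sterm -> sterm -> Prop :=
  | star_rel_of t u : rel t u -> star_rel t u
  | star_rel_adj t u : rel t u -> star_rel (tadj t) (tadj u).

Definition staralg : Type := palg star_rel.

HB.instance Definition _ := GRing.PzRing.on staralg.
HB.instance Definition _ := GRing.Lmodule.on staralg.

Definition star : staralg -> staralg := palg_anti Num.conj adj_gen.

Lemma tadjK : involutive tadj.
Proof.
by elim=> [[x b]|c|t IHt u IHu|t IHt u IHu] /=;
  rewrite /tadj /= /adj_gen /= ?negbK ?conjCK // -!/(tadj _) ?IHt ?IHu.
Qed.

Lemma starE t : star (class_of _ t) = class_of _ (tadj t).
Proof.
apply: palg_antiE => {}t u [] {}t {}u tu; apply/class_ofP; apply: cong_rel.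
  exact: star_rel_adj.
by rewrite -!/(tadj _) !tadjK; exact: star_rel_of.
Qed.

Lemma starK : involutive star.
Proof. by elim/palg_ind=> t; rewrite !starE tadjK. Qed.

Lemma starD : {morph star : x y / x + y}.
Proof.
elim/palg_ind=> t; elim/palg_ind=> u.
by rewrite -class_ofD !starE -class_ofD.
Qed.

Lemma starM x y : star (x * y) = star y * star x.
Proof.
elim/palg_ind: x => t; elim/palg_ind: y => u.
by rewrite -class_ofM !starE -class_ofM.
Qed.

Lemma starZ c x : star (c *: x) = c^* *: star x.
Proof.
elim/palg_ind: x => t; rewrite -class_ofZ !starE /= class_ofM class_ofC.
by rewrite -palg_scaleAr mulr1.
Qed.

Lemma star1 : star 1 = 1.
Proof. by rewrite -[1]class_of1 starE /tadj /= conjC1. Qed.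

End StarPresented.

Declare Scope pterm_scope.
Delimit Scope pterm_scope with pt.
Notation "t + u" := (Add t u) : pterm_scope.
Notation "t * u" := (Mul t u) : pterm_scope.
Notation "c *: t" := (Mul (Cst c) t) : pterm_scope.
Notation "t - u" := (Add t (Mul (Cst (-1)) u)) : pterm_scope.

(* All indices are shifted by one: the Dynkin node [i : 'I_r] is usually numbered
   [i.+1], and likewise for the rows and columns of the quantum matrix below. *)
Inductive ugen (r : nat) : Type :=
  | UE of 'I_r
  | UF of 'I_r
  | UK of 'I_r
  | UKinv of 'I_r.

Section QuantumGroup.
Variables (R : realType) (q : R) (N : nat).
Local Notation C := R[i].
Local Notation qC := (q%:C%C : C).

Definition adjacent (i j : 'I_N.-1) : bool := (i.+1 == j) || (j.+1 == i).

Definition cartan (i j : 'I_N.-1) : int :=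
  if i == j then 2 else if adjacent i j then -1 else 0.

Definition uterm : Type := term C (ugen N.-1).

Definition tE (i : 'I_N.-1) : uterm := Gen (UE i).
Definition tF (i : 'I_N.-1) : uterm := Gen (UF i).
Definition tK (i : 'I_N.-1) : uterm := Gen (UK i).
Definition tKinv (i : 'I_N.-1) : uterm := Gen (UKinv i).

Inductive uq_rel : uterm -> uterm -> Prop :=
  | uq_KK i j : uq_rel (tK i * tK j)%pt (tK j * tK i)%pt
  | uq_KKinv i : uq_rel (tK i * tKinv i)%pt (Cst 1)
  | uq_KinvK i : uq_rel (tKinv i * tK i)%pt (Cst 1)
  | uq_KE i j :
      uq_rel (tK i * tE j)%pt (qC ^ cartan i j *: (tE j * tK i))%pt
  | uq_KF i j :
      uq_rel (tK i * tF j)%pt (qC ^ (- cartan i j) *: (tF j * tK i))%pt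
  | uq_EF i j :
      uq_rel (tE i * tF j - tF j * tE i)%pt
             (((i == j)%:R / (qC - qC^-1)) *: (tK i - tKinv i))%pt
  | uq_serreE i j : adjacent i j ->
      uq_rel (tE i * tE i * tE j - (qC + qC^-1) *: (tE i * tE j * tE i)
              + tE j * tE i * tE i)%pt (Cst 0)
  | uq_serreF i j : adjacent i j ->
      uq_rel (tF i * tF i * tF j - (qC + qC^-1) *: (tF i * tF j * tF i)
              + tF j * tF i * tF i)%pt (Cst 0)
  | uq_EE i j : ~~ adjacent i j -> uq_rel (tE i * tE j)%pt (tE j * tE i)%pt
  | uq_FF i j : ~~ adjacent i j -> uq_rel (tF i * tF j)%pt (tF j * tF i)%pt.

Definition Uq : Type := palg uq_rel.

HB.instance Definition _ := GRing.PzRing.on Uq.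
HB.instance Definition _ := GRing.Lmodule.on Uq.

Definition uE (i : 'I_N.-1) : Uq := class_of _ (tE i).
Definition uF (i : 'I_N.-1) : Uq := class_of _ (tF i).
Definition uK (i : 'I_N.-1) : Uq := class_of _ (tK i).
Definition uKinv (i : 'I_N.-1) : Uq := class_of _ (tKinv i).

Lemma uq_relP t u : uq_rel t u -> class_of uq_rel t = class_of uq_rel u.
Proof. by move=> tu; apply/class_ofP; exact: cong_rel. Qed.

Definition counit_gen (x : ugen N.-1) : C :=
  match x with
  | UE _ | UF _ => 0
  | UK _ | UKinv _ => 1
  end.

Definition counit (x : Uq) : C := teval counit_gen (repr x).

Lemma counitE t : counit (class_of _ t) = teval counit_gen t.
Proof.
apply: (@teval_cong _ _ uq_rel); last exact: repr_class_of.
move=> {}t u [] //= *.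
all: by rewrite ?(mulr0, mul0r, mulr1, mulN1r, oppr0, addr0, subrr).
Qed.

Definition antipode_gen (x : ugen N.-1) : uterm :=
  match x with
  | UE i => (-1 *: (tKinv i * tE i))%pt
  | UF i => (-1 *: (tF i * tK i))%pt
  | UK i => tKinv i
  | UKinv i => tK i
  end.

(* Independent of the representative for q != 0, by [antipodeE] below. *)
Definition antipode : Uq -> Uq := palg_anti idfun antipode_gen.

(* The sign is -1 exactly at the [n]-th node. *)
Definition star_sign (n : nat) (i : 'I_N.-1) : C := if i.+1 == n then -1 else 1.

Definition ustar_gen (n : nat) (x : ugen N.-1) : uterm :=
  match x with
  | UE i => (star_sign n i *: (tK i * tF i))%pt
  | UF i => (star_sign n i *: (tE i * tKinv i))%pt
  | UK i => tK i
  | UKinv i => tKinv i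
  end.

(* The involution of U_q su_{n,m}, N = m + n; independent of the representative
   for q != 0, by [ustarE] below. *)
Definition ustar (n : nat) : Uq -> Uq := palg_anti Num.conj (ustar_gen n).

Lemma uKKinv i : uK i * uKinv i = 1.
Proof. by rewrite -class_ofM (uq_relP (uq_KKinv i)). Qed.

Lemma uKinvK i : uKinv i * uK i = 1.
Proof. by rewrite -class_ofM (uq_relP (uq_KinvK i)). Qed.

Lemma uKKC i j : uK i * uK j = uK j * uK i.
Proof. by rewrite -!class_ofM (uq_relP (uq_KK i j)). Qed.

Lemma uKEC i j : uK i * uE j = qC ^ cartan i j *: (uE j * uK i).
Proof. by rewrite -!class_ofM (uq_relP (uq_KE i j)) class_ofZ. Qed.

Lemma uKFC i j : uK i * uF j = qC ^ (- cartan i j) *: (uF j * uK i).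
Proof. by rewrite -!class_ofM (uq_relP (uq_KF i j)) class_ofZ. Qed.

Lemma uEFC i j :
  uE i * uF j - uF j * uE i
  = ((i == j)%:R / (qC - qC^-1)) *: (uK i - uKinv i).
Proof.
have := uq_relP (uq_EF i j).
by rewrite !(class_ofZ, class_ofD, class_ofM, class_ofZ) !scaleN1r.
Qed.

End QuantumGroup.

Section Skew.
Variables (K : fieldType) (X : Type) (rel : term K X -> term K X -> Prop).
Variables (I : Type) (e L x : I -> palg rel) (c : I -> I -> K) (s : I -> K).
Hypothesis eL : forall i j, e i * L j = c i j *: (L j * e i).
Hypothesis cC : forall i j, c i j = c j i.
Hypothesis LC : forall i j, L i * L j = L j * L i.
Hypothesis xE : forall i, x i = s i *: (L i * e i).

Lemma skew2 i j :
  x i * x j = (s i * s j * c i j) *: (L i * L j * (e i * e j)).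
Proof.
rewrite !xE -palg_scaleAl -palg_scaleAr !scalerA.
have -> : L i * e i * (L j * e j) = L i * (e i * L j) * e j by rewrite !mulrA.
by rewrite eL -palg_scaleAr -palg_scaleAl scalerA !mulrA.
Qed.

Lemma skew3 i j k :
  x i * x j * x k = (s i * s j * s k * (c i j * c i k * c j k))
                      *: (L i * L j * L k * (e i * e j * e k)).
Proof.
rewrite skew2 xE -palg_scaleAl -palg_scaleAr !scalerA.
have -> : L i * L j * (e i * e j) * (L k * e k)
          = L i * L j * (e i * (e j * L k)) * e k by rewrite !mulrA.
rewrite eL -!palg_scaleAr (mulrA (e i)) eL.
rewrite -!(palg_scaleAl, palg_scaleAr) !scalerA !mulrA.
by congr (_ *: _); ring.
Qed.

Lemma skew_comm i j : e i * e j = e j * e i -> x j * x i = x i * x j.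
Proof. by move=> ee; rewrite !skew2 ee LC cC (mulrC (s j)). Qed.

Lemma skew_serre b i j :
  e i * e i * e j - b *: (e i * e j * e i) + e j * e i * e i = 0 ->
  x j * x i * x i - b *: (x i * x j * x i) + x i * x i * x j = 0.
Proof.
move=> ee; rewrite !skew3.
have L1 : L j * L i * L i = L i * L i * L j by rewrite LC -mulrA LC mulrA.
have L2 : L i * L j * L i = L i * L i * L j by rewrite -mulrA (LC j) mulrA.
rewrite L1 L2 !(cC j i).
have -> : s j * s i * s i * (c i j * c i j * c i i)
          = s i * s i * s j * (c i i * c i j * c i j) by ring.
have -> : s i * s j * s i * (c i j * c i i * c i j)
          = s i * s i * s j * (c i i * c i j * c i j) by ring.
set k := s i * s i * s j * _.
rewrite (scalerA b k) (mulrC b) -(scalerA k b) -scalerBr -scalerDr.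
rewrite palg_scaleAr -mulrBr -mulrDr.
have -> : e j * e i * e i - b *: (e i * e j * e i) + e i * e i * e j = 0.
  by rewrite -[RHS]ee addrC addrA addrAC.
by rewrite mulr0 scaler0.
Qed.

End Skew.

Section QuantumGroupTheory.
Variables (R : realType) (q : R) (N : nat).
Hypothesis q_neq0 : q != 0.
Local Notation C := R[i].
Local Notation qC := (q%:C%C : C).
Local Notation uE := (@uE R q N).
Local Notation uF := (@uF R q N).
Local Notation uK := (@uK R q N).
Local Notation uKinv := (@uKinv R q N).

Let qC_neq0 : qC != 0.
Proof. by rewrite -(rmorph0 (real_complex R)) (inj_eq (@complexI _)). Qed.

Let qCz_neq0 (z : int) : qC ^ z != 0.
Proof. by rewrite expfz_neq0. Qed.

Lemma cartanC (i j : 'I_N.-1) : cartan i j = cartan j i.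
Proof. by rewrite /cartan eq_sym /adjacent orbC. Qed.

Lemma uKKinvC i j : uK i * uKinv j = uKinv j * uK i.
Proof.
rewrite -[LHS]mul1r -(uKinvK q j) !mulrA -(mulrA (uKinv j)) uKKC.
by rewrite !mulrA -[RHS]mulr1 -(uKKinv q j) !mulrA.
Qed.

Lemma uKinvKinvC i j : uKinv i * uKinv j = uKinv j * uKinv i.
Proof.
rewrite -[LHS]mulr1 -(uKKinv q i) -!mulrA (mulrA (uKinv j)) -uKKinvC.
by rewrite !mulrA uKinvK mul1r.
Qed.

Lemma uEKinvC i j : uE i * uKinv j = qC ^ cartan i j *: (uKinv j * uE i).
Proof.
rewrite -[LHS]mul1r -(uKinvK q j) -!mulrA (mulrA (uK j)) uKEC.
by rewrite -palg_scaleAl -!palg_scaleAr -!mulrA uKKinv mulr1 cartanC.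
Qed.

Lemma uFKinvC i j : uF i * uKinv j = qC ^ (- cartan i j) *: (uKinv j * uF i).
Proof.
rewrite -[LHS]mul1r -(uKinvK q j) -!mulrA (mulrA (uK j)) uKFC.
by rewrite -palg_scaleAl -!palg_scaleAr -!mulrA uKKinv mulr1 cartanC.
Qed.

Lemma uFKC i j : uF i * uK j = qC ^ cartan i j *: (uK j * uF i).
Proof.
by rewrite uKFC scalerA cartanC -expfzDr ?qC_neq0 // addrN expr0z scale1r.
Qed.

Lemma uEKC i j : uE i * uK j = qC ^ (- cartan i j) *: (uK j * uE i).
Proof.
by rewrite uKEC scalerA cartanC -expfzDr ?qC_neq0 // addNr expr0z scale1r.
Qed.

Lemma uSerreE i j : adjacent i j ->
  uE i * uE i * uE j - (qC + qC^-1) *: (uE i * uE j * uE i)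
    + uE j * uE i * uE i = 0.
Proof.
move=> /(uq_serreE q)/uq_relP.
by rewrite !(class_ofZ, class_ofD, class_ofM) scaleN1r.
Qed.

Lemma uSerreF i j : adjacent i j ->
  uF i * uF i * uF j - (qC + qC^-1) *: (uF i * uF j * uF i)
    + uF j * uF i * uF i = 0.
Proof.
move=> /(uq_serreF q)/uq_relP.
by rewrite !(class_ofZ, class_ofD, class_ofM) scaleN1r.
Qed.

Lemma uEE i j : ~~ adjacent i j -> uE i * uE j = uE j * uE i.
Proof. by move=> /(uq_EE q)/uq_relP; rewrite !class_ofM. Qed.

Lemma uFF i j : ~~ adjacent i j -> uF i * uF j = uF j * uF i.
Proof. by move=> /(uq_FF q)/uq_relP; rewrite !class_ofM. Qed.

Lemma qCz_conj (z : int) : (qC ^ z)^* = qC ^ z.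
Proof.
by apply/CrealP; apply: rpredXz; apply/complex_realP; exists q.
Qed.

Local Notation cls := (class_of (@uq_rel R q N)).

Let clsE := (@class_ofZ _ _ (@uq_rel R q N), @class_ofZr _ _ (@uq_rel R q N),
             @class_ofD _ _ (@uq_rel R q N), @class_ofM _ _ (@uq_rel R q N),
             @class_ofC _ _ (@uq_rel R q N)).

Lemma antipode_wd t u : uq_rel q t u ->
  cls (tanti idfun (@antipode_gen R N) t)
  = cls (tanti idfun (@antipode_gen R N) u).
Proof.
have eLE i j := uEKinvC i j.
have eLF i j := uFKC i j.
have cC (i j : 'I_N.-1) : qC ^ cartan i j = qC ^ cartan j i by rewrite cartanC.
have xE i : -1 *: (uKinv i * uE i) = -1 *: (uKinv i * uE i) by [].
have xF i : -1 *: (uF i * uK i) = (-1 * qC ^ 2) *: (uK i * uF i).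
  by rewrite uFKC scalerA /cartan eqxx.
have KFE i j : uF j * uK j * (uKinv i * uE i)
               = uKinv i * (uF j * uE i) * uK j.
  rewrite -!mulrA (mulrA (uK j) (uKinv i)) uKKinvC -!mulrA uKEC.
  rewrite -!palg_scaleAr !(mulrA (uF j) (uKinv i)) uFKinvC -palg_scaleAl.
  rewrite scalerA cartanC -expfzDr ?qC_neq0 // subrr expr0z scale1r.
  by rewrite !mulrA.
case; rewrite /=.
- by move=> i j; rewrite !clsE; exact: uKinvKinvC.
- by move=> i; rewrite !clsE scale1r; exact: uKKinv.
- by move=> i; rewrite !clsE scale1r; exact: uKinvK.
- move=> i j; rewrite !clsE -/(uKinv _) -/(uE _).
  rewrite -palg_scaleAl -palg_scaleAr scalerA -mulrA eLE -palg_scaleAr !mulrA.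
  by rewrite uKinvKinvC cartanC scalerA mulrC.
- move=> i j; rewrite !clsE -/(uKinv _) -/(uF _) -/(uK _).
  rewrite -palg_scaleAl -palg_scaleAr scalerA -mulrA uKKinvC (mulrA (uF j) (uKinv i)) uFKinvC.
  by rewrite -palg_scaleAl -!mulrA scalerA cartanC mulrC.
- move=> i j; rewrite !clsE -/(uKinv _) -/(uF _) -/(uK _) -/(uE _) -/(uKinv _).
  rewrite -!palg_scaleAl -!palg_scaleAr !scalerA !scaleN1r mulrNN mulr1.
  rewrite !scale1r KFE.
  rewrite mul1r scaleN1r -[cls (tK _ _)]/(uK _).
  have -> : uKinv i * uE i * (uF j * uK j) = uKinv i * (uE i * uF j) * uK j.
    by rewrite !mulrA.
  rewrite -mulrBl -mulrBr -opprB uEFC mulrN mulNr -palg_scaleAr -palg_scaleAl.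
  have [<-|_] := eqVneq i j; last by rewrite mul0r !scale0r oppr0.
  by rewrite mulrBr uKinvK mulrBl mul1r -mulrA uKinvK mulr1 mul1r -scalerN opprB.
- move=> i j ij; rewrite !clsE -/(uKinv _) -/(uE _) -/(uKinv _) -/(uE _).
  rewrite scale0r.
  have := skew_serre eLE cC (@uKinvKinvC) xE (uSerreE ij).
  by rewrite !mulrA scaleN1r.
- move=> i j ij; rewrite !clsE -/(uK _) -/(uF _) -/(uK _) -/(uF _).
  rewrite scale0r.
  have := skew_serre eLF cC (@uKKC R q N) xF (uSerreF ij).
  by rewrite !mulrA scaleN1r.
- move=> i j ij; rewrite !clsE -/(uKinv _) -/(uE _) -/(uKinv _) -/(uE _).
  exact: skew_comm eLE cC (@uKinvKinvC) xE _ _ (uEE ij).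
- move=> i j ij; rewrite !clsE -/(uK _) -/(uF _) -/(uK _) -/(uF _).
  exact: skew_comm eLF cC (@uKKC R q N) xF _ _ (uFF ij).
Qed.

Lemma antipodeE t :
  antipode (cls t) = cls (tanti idfun (@antipode_gen R N) t).
Proof. exact: (@palg_antiE _ _ _ idfun) antipode_wd t. Qed.

Lemma ustar_wd n t u : uq_rel q t u ->
  cls (tanti Num.conj (@ustar_gen R N n) t)
  = cls (tanti Num.conj (@ustar_gen R N n) u).
Proof.
have qR : qC \is Num.real by apply/complex_realP; exists q.
have conjr (c : C) : c \is Num.real -> c^* = c by move/CrealP.
have eLE i j := uFKC i j.
have eLF i j := uEKinvC i j.
have cC (i j : 'I_N.-1) : qC ^ cartan i j = qC ^ cartan j i by rewrite cartanC.
pose s := @star_sign R N n.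
have ss i : s i * s i = 1 by rewrite /s /star_sign; case: ifP; rewrite ?mulrNN mulr1.
have xE i : s i *: (uK i * uF i) = s i *: (uK i * uF i) by [].
have xF i : s i *: (uE i * uKinv i) = (s i * qC ^ 2) *: (uKinv i * uE i).
  by rewrite uEKinvC scalerA /cartan eqxx.
have KinvF i j : uKinv j * uF i = qC ^ cartan i j *: (uF i * uKinv j).
  rewrite uFKinvC scalerA -expfzDr ?qC_neq0 // subrr expr0z scale1r //.
have KFE i j : uE j * uKinv j * (uK i * uF i)
               = uK i * (uE j * uF i) * uKinv j.
  rewrite -!mulrA (mulrA (uKinv j) (uK i)) -uKKinvC -!mulrA.
  rewrite KinvF -!palg_scaleAr (mulrA (uE j) (uK i)) uEKC -palg_scaleAl.
  by rewrite scalerA cartanC -expfzDr ?qC_neq0 // subrr expr0z scale1r !mulrA.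
case; rewrite /=.
- by move=> i j; rewrite !clsE; exact: uKKC.
- by move=> i; rewrite !clsE conjC1 scale1r; exact: uKinvK.
- by move=> i; rewrite !clsE conjC1 scale1r; exact: uKKinv.
- move=> i j; rewrite !clsE qCz_conj -/(uK _) -/(uF _).
  rewrite -palg_scaleAl -palg_scaleAr scalerA -mulrA eLE -palg_scaleAr.
  by rewrite !mulrA uKKC cartanC scalerA mulrC.
- move=> i j; rewrite !clsE qCz_conj -/(uKinv _) -/(uE _) -/(uK _).
  rewrite -palg_scaleAl -palg_scaleAr scalerA -mulrA -uKKinvC.
  rewrite (mulrA (uE j) (uK i)) uEKC -palg_scaleAl scalerA cartanC mulrC.
  by rewrite !mulrA.
- move=> i j; rewrite !clsE !rmorphN1 (conjr (_ / _)); last first.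
    by rewrite rpred_div ?rpred_nat ?rpredB ?rpredV.
  rewrite -[cls (tKinv R i)]/(uKinv i) -!/(s _).
  rewrite -!palg_scaleAl -!palg_scaleAr !scalerA !scaleN1r mulN1r KFE.
  have -> : uK i * uF i * (uE j * uKinv j) = uK i * (uF i * uE j) * uKinv j.
    by rewrite !mulrA.
  rewrite (mulrC (s j)) mulNr scaleNr.
  rewrite -scalerBr -mulrBl -mulrBr uEFC -palg_scaleAr -palg_scaleAl scalerA.
  have [<-|_] := eqVneq i j; last by rewrite mul0r mulr0 !scale0r.
  rewrite ss !mul1r mulrBr mulrBl -!mulrA uKKinv mulr1 (mulrA (uK i)) uKKinv.
  by rewrite mul1r.
- move=> i j ij; rewrite !clsE conjC0 scale0r rmorphN1 (conjr (_ + _)).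
    have := skew_serre eLE cC (@uKKC R q N) xE (uSerreF ij).
    by rewrite !mulrA scaleN1r.
  by rewrite rpredD ?rpredV.
- move=> i j ij; rewrite !clsE conjC0 scale0r rmorphN1 (conjr (_ + _)).
    have := skew_serre eLF cC (@uKinvKinvC) xF (uSerreE ij).
    by rewrite !mulrA scaleN1r.
  by rewrite rpredD ?rpredV.
- move=> i j ij; rewrite !clsE.
  exact: skew_comm eLE cC (@uKKC R q N) xE _ _ (uFF ij).
- move=> i j ij; rewrite !clsE.
  exact: skew_comm eLF cC (@uKinvKinvC) xF _ _ (uEE ij).
Qed.

Lemma ustarE n t :
  ustar n (cls t) = cls (tanti Num.conj (@ustar_gen R N n) t).
Proof. exact: (@palg_antiE _ _ _ Num.conj) (@ustar_wd n) t. Qed.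
End QuantumGroupTheory.

Section Coproduct.
Variables (R : realType) (q : R) (N : nat).
Local Notation Uq := (Uq q N).

(* [coprod t] lists the simple tensors of a representative of the coproduct of
   the class of [t]: if it is [:: (x1, y1); ...; (xk, yk)] then the coproduct
   is x1 (x) y1 + ... + xk (x) yk. *)
Fixpoint coprod (t : uterm R N) : seq (Uq * Uq) :=
  match t with
  | Gen (UE i) => [:: (uE q i, 1); (uK q i, uE q i)]
  | Gen (UF i) => [:: (uF q i, uKinv q i); (1, uF q i)]
  | Gen (UK i) => [:: (uK q i, uK q i)]
  | Gen (UKinv i) => [:: (uKinv q i, uKinv q i)]
  | Cst c => [:: (c *: (1 : Uq), 1)]
  | Add t u => coprod t ++ coprod u
  | Mul t u =>
      [seq (x.1 * y.1, x.2 * y.2) | x <- coprod t, y <- coprod u]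
  end.

(* e^{h rho}, in terms of the usual numbering of the nodes from 1 to N - 1. *)
Definition exp_hrho : Uq :=
  \prod_(i < N.-1) uKinv q i ^+ (i.+1 * (N - i.+1)).

End Coproduct.

(* [Z a al] is z_{a+1}^{al+1}. *)
Inductive fgen (m n : nat) : Type :=
  | Z of 'I_n & 'I_m
  | F0.
Arguments F0 {m n}.

Section FiniteFunctions.
Variables (R : realType) (q : R) (m n : nat).
Local Notation C := R[i].
Local Notation qC := (q%:C%C : C).

Definition fterm : Type := sterm C (fgen m n).

Definition tz (a : 'I_n) (al : 'I_m) : fterm := Gen (Z a al, false).
Definition tzs (a : 'I_n) (al : 'I_m) : fterm := Gen (Z a al, true).
Definition tf0 : fterm := Gen (F0, false).
Definition tf0s : fterm := Gen (F0, true).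

Definition rcoef (b a b' a' : nat) : C :=
  if [&& a != b, b == b' & a == a'] then qC^-1
  else if [&& a == b, b == a' & a' == b'] then 1
  else if [&& a == b, a' == b' & (a < a')%N] then - (qC ^- 2 - 1)
  else 0.

Inductive pol_rel : fterm -> fterm -> Prop :=
  | pol_row a (al1 al2 : 'I_m) : (al1 < al2)%N ->
      pol_rel (tz a al1 * tz a al2)%pt (qC *: (tz a al2 * tz a al1))%pt
  | pol_col (a1 a2 : 'I_n) al : (a1 < a2)%N ->
      pol_rel (tz a1 al * tz a2 al)%pt (qC *: (tz a2 al * tz a1 al))%pt
  | pol_comm (a1 a2 : 'I_n) (al1 al2 : 'I_m) : (al1 < al2)%N -> (a2 < a1)%N ->
      pol_rel (tz a1 al1 * tz a2 al2)%pt (tz a2 al2 * tz a1 al1)%pt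
  | pol_cross (a1 a2 : 'I_n) (al1 al2 : 'I_m) : (al1 < al2)%N -> (a1 < a2)%N ->
      pol_rel (tz a1 al1 * tz a2 al2 - tz a2 al2 * tz a1 al1)%pt
              ((qC - qC^-1) *: (tz a1 al2 * tz a2 al1))%pt
  | pol_star (a b : 'I_n) (al be : 'I_m) :
      pol_rel (tzs b be * tz a al)%pt
        (qC ^+ 2 *:
           (\big[@Add _ _ / Cst 0]_(a' < n) \big[@Add _ _ / Cst 0]_(b' < n)
            \big[@Add _ _ / Cst 0]_(al' < m) \big[@Add _ _ / Cst 0]_(be' < m)
              ((rcoef b a b' a' * rcoef be al be' al')%R
                 *: (tz a' al' * tzs b' be')))
         + Cst ((1 - qC ^+ 2) * ((a == b) && (al == be))%:R)%R)%pt.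

Inductive fun_rel : fterm -> fterm -> Prop :=
  | fun_pol t u : pol_rel t u -> fun_rel t u
  | fun_f0f0 : fun_rel (tf0 * tf0)%pt tf0
  | fun_f0s : fun_rel tf0s tf0
  | fun_zsf0 a al : fun_rel (tzs a al * tf0)%pt (Cst 0)
  | fun_f0z a al : fun_rel (tf0 * tz a al)%pt (Cst 0).

Definition Fun : Type := staralg fun_rel.

HB.instance Definition _ := GRing.PzRing.on Fun.
HB.instance Definition _ := GRing.Lmodule.on Fun.

Definition fz (a : 'I_n) (al : 'I_m) : Fun := class_of _ (tz a al).
Definition f0 : Fun := class_of _ tf0.
Definition fstar : Fun -> Fun := @star _ _ fun_rel.

Local Notation Uq := (Uq q (m + n)).

(* [act xi f] is xi f.  Every element of [Uq] is the class of a term [t], so that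
   [act_coprod] is the module algebra axiom for the whole of [Uq]. *)
Record covariant (act : Uq -> Fun -> Fun) : Prop := Covariant {
  act_linearl : forall c x y f, act (c *: x + y) f = c *: act x f + act y f;
  act_linearr : forall x c f g, act x (c *: f + g) = c *: act x f + act x g;
  act_unit : forall f, act 1 f = f;
  act_mul : forall x y f, act (x * y) f = act x (act y f);
  act_one : forall x, act x 1 = counit x *: (1 : Fun);
  act_coprod : forall t f g,
    act (class_of _ t) (f * g)
    = \sum_(p <- coprod q t) act p.1 f * act p.2 g;
  act_star : forall x f,
    fstar (act x f) = act (ustar n (antipode x)) (fstar f)
}.

Local Notation sqrtq := ((Num.sqrt q)%:C%C : C).

(* With [covariant], these values determine the action: those on the adjoints of
   the generators come from [act_star].  The node [j] is the [j.+1]-st one. *)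
Record fun_action (act : Uq -> Fun -> Fun) : Prop := FunAction {
  act_low : forall (j : 'I_(m + n).-1) a al, (j.+1 < n)%N ->
    [/\ act (uK q j) (fz a al)
        = (if a == j :> nat then qC else if a == j.+1 :> nat then qC^-1 else 1)
            *: fz a al,
        forall b : 'I_n, a = j.+1 :> nat -> b = j :> nat ->
          act (uE q j) (fz a al) = sqrtq^-1 *: fz b al,
        a <> j.+1 :> nat -> act (uE q j) (fz a al) = 0,
        forall b : 'I_n, a = j :> nat -> b = j.+1 :> nat ->
          act (uF q j) (fz a al) = sqrtq *: fz b al
      & a <> j :> nat -> act (uF q j) (fz a al) = 0];
  act_high : forall (j : 'I_(m + n).-1) i a al, (0 < i)%N -> j.+1 = (n + i)%N ->
    [/\ act (uK q j) (fz a al)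
        = (if al.+1 == (m - i)%N then qC
           else if al.+1 == (m - i + 1)%N then qC^-1 else 1) *: fz a al,
        forall be : 'I_m, al.+1 = (m - i + 1)%N -> be.+1 = (m - i)%N ->
          act (uE q j) (fz a al) = sqrtq^-1 *: fz a be,
        al.+1 <> (m - i + 1)%N -> act (uE q j) (fz a al) = 0,
        forall be : 'I_m, al.+1 = (m - i)%N -> be.+1 = (m - i + 1)%N ->
          act (uF q j) (fz a al) = sqrtq *: fz a be
      & al.+1 <> (m - i)%N -> act (uF q j) (fz a al) = 0];
  act_mid : forall (j : 'I_(m + n).-1) (a a' : 'I_n) (al al' : 'I_m),
    j.+1 = n -> a'.+1 = n -> al'.+1 = m ->
    [/\ act (uK q j) (fz a al)
        = (if (a == a') && (al == al') then qC ^+ 2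
           else if (a == a') || (al == al') then qC else 1) *: fz a al,
        act (uF q j) (fz a al)
        = (sqrtq * ((a == a') && (al == al'))%:R) *: (1 : Fun)
      & act (uE q j) (fz a al)
        = if (a == a') && (al == al') then - sqrtq *: (fz a' al') ^+ 2
          else if (a != a') && (al != al')
            then - sqrtq^-1 *: (fz a al' * fz a' al)
          else - sqrtq *: (fz a' al' * fz a al)];
  act_f0_mid : forall (j : 'I_(m + n).-1) (a' : 'I_n) (al' : 'I_m),
    j.+1 = n -> a'.+1 = n -> al'.+1 = m ->
    [/\ act (uK q j) f0 = f0,
        act (uKinv q j) f0 = f0,
        act (uE q j) f0 = - (sqrtq / (1 - qC ^+ 2)) *: (fz a' al' * f0)
      & act (uF q j) f0
        = - (sqrtq / (qC ^- 2 - 1)) *: (f0 * fstar (fz a' al'))];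
  act_f0 : forall j : 'I_(m + n).-1, j.+1 != n ->
    [/\ act (uK q j) f0 = f0, act (uKinv q j) f0 = f0,
        act (uE q j) f0 = 0 & act (uF q j) f0 = 0]
}.

Inductive CMat : Fun -> Prop :=
  | CMat_z a al : CMat (fz a al)
  | CMat_1 : CMat 1
  | CMat_D f g : CMat f -> CMat g -> CMat (f + g)
  | CMat_Z c f : CMat f -> CMat (c *: f)
  | CMat_M f g : CMat f -> CMat g -> CMat (f * g).

Definition DU : set Fun :=
  [set f | exists s : seq (Fun * Fun), f = \sum_(p <- s) p.1 * f0 * p.2].

Definition HU : set Fun := [set f | exists2 psi, CMat psi & f = psi * f0].

(* Both are considered on [HU] only.  The domain U_q p_+ of Gamma is left
   implicit: Gamma is a restriction of [act], and it is only evaluated at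
   [exp_hrho], a product of the generators K_i^{-1}. *)
Definition Theta (psi : Fun) (f : Fun) : Fun := psi * f.
Definition Gamma (act : Uq -> Fun -> Fun) (xi : Uq) (f : Fun) : Fun := act xi f.

Definition nonnegative (f : Fun) : Prop :=
  exists2 s : seq Fun, {in s, forall g, DU g} & f = \sum_(g <- s) fstar g * g.

End FiniteFunctions.

Section Trace.
Variables (K : fieldType) (V : lmodType K).

(* Operators on the subspace [H] of [V] are given by maps [V -> V]; only their
   restriction to [H] matters. *)
Definition range_in_span (H : set V) (T : V -> V) (k : nat) (v : 'I_k -> V) :=
  (forall i, H (v i)) /\
  forall x, H x -> exists c : 'I_k -> K, T x = \sum_i c i *: v i.

Definition finite_rank (H : set V) (T : V -> V) : Prop :=
  (forall x, H x -> H (T x)) /\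
  exists k (v : 'I_k -> V), range_in_span H T v.

(* [t] is the trace of the matrix of [T] on a finite-dimensional subspace of
   [H] containing the range of [T]. *)
Definition is_trace (H : set V) (T : V -> V) (t : K) : Prop :=
  exists k (v : 'I_k -> V) (A : 'M[K]_k),
    [/\ range_in_span H T v,
        forall c : 'I_k -> K, \sum_i c i *: v i = 0 -> forall i, c i = 0,
        forall j, T (v j) = \sum_i A i j *: v i
      & t = \tr A].

Definition trace (H : set V) (T : V -> V) : K := xget 0 [set t | is_trace H T t].

End Trace.

Section Integral.
Variables (R : realType) (q : R) (m n : nat).
Variable act : Uq q (m + n) -> Fun q m n -> Fun q m n.

Definition nu_operator (f : Fun q m n) : Fun q m n -> Fun q m n :=
  Theta f \o Gamma act (exp_hrho q (m + n)).

Definition integral (f : Fun q m n) : R[i] :=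
  trace (@HU R q m n) (nu_operator f).

End Integral.

(* Main.v *)
(* Since f0 Fun f0 = C f0, write f0 x f0 = vac(x) f0.  Then the operator attached
   to a f0 b is x |-> vac(b rho(x)) a f0 on H = Fun f0, where rho is the action of
   e^{h rho-check}, so that the integral of a f0 b is vac(b rho(a)).

   Invariance is checked on the generators of U_q sl_N.  Applying E_i to
   f0 x f0 = vac(x) f0, and using f0 (E_i f0) = 0, expresses vac(E_i x) by
   vac((K_i x) (E_i f0)); for x = b rho(K_i a) this cancels the integral of
   E_i (a f0 b), because rho E_i = q^{-2} E_i rho.  F_i is similar.

   For positivity, order the generators z_a^alpha lexicographically.  Moving the
   adjoint of z_h to the right past z_g only produces adjoints of z_{h'} with
   h' >= h, so it kills f0 multiplied by monomials in smaller generators and acts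
   as a q-oscillator on the powers of z_h.  Hence the monomials with decreasing
   factors are orthogonal in H, with square norms the products of the 1 - q^{2j}.
   They span H, and they are eigenvectors of rho for positive eigenvalues; so the
   integral of g^* g is a sum of squares of absolute values of the coefficients of
   g, with positive weights. *)
Require Import Defs.
From mathcomp Require Import all_boot all_order all_algebra.
From mathcomp Require Import complex boolp classical_sets reals.
From mathcomp Require Import ring zify.

Set Implicit Arguments.
Unset Strict Implicit.
Unset Printing Implicit Defensive.

Import Order.TTheory GRing.Theory Num.Theory.
Local Open Scope ring_scope.

(** * Traces of finite-rank operators *)

Section TraceTheory.
Variables (K : fieldType) (V : lmodType K).

Definition free_family k (v : 'I_k -> V) :=
  forall c : 'I_k -> K, \sum_i c i *: v i = 0 -> forall i, c i = 0.

Definition in_span k (v : 'I_k -> V) (x : V) :=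
  exists c : 'I_k -> K, x = \sum_i c i *: v i.

Lemma free_family_inj k (v : 'I_k -> V) (a b : 'I_k -> K) : free_family v ->
  \sum_i a i *: v i = \sum_i b i *: v i -> a =1 b.
Proof.
move=> v_free ab i; apply/eqP; rewrite -subr_eq0; apply/eqP.
apply: (v_free (fun i => a i - b i)).
under eq_bigr do rewrite scalerBl.
by rewrite sumrB ab subrr.
Qed.

Lemma free_subfamily (s : seq V) : exists b : seq V,
  [/\ {subset b <= s}, free_family (fun i : 'I_(size b) => b`_i)
    & forall x, x \in s -> in_span (fun i : 'I_(size b) => b`_i) x].
Proof.
elim: s => [|y s [b [bs b_free b_span]]].
  by exists [::]; split=> // c _ [].
have [y_span|y_span] := pselect (in_span (fun i : 'I_(size b) => b`_i) y).
  exists b; split=> // [x /bs xs|x]; first by rewrite inE xs orbT.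
  by rewrite inE => /orP[/eqP ->|/b_span].
exists (y :: b); split=> [x|c|x].
- by rewrite !inE => /orP[->//|/bs ->]; rewrite orbT.
- rewrite big_ord_recl /= => c0.
  (* A non-zero coefficient at [y] could be inverted, which would put [y] in the span of [b]. *)
  have cz : c ord0 = 0.
    apply/eqP; apply: contra_notT y_span => cn0.
    exists (fun i => - (c ord0)^-1 * c (lift ord0 i)).
    under eq_bigr do rewrite -scalerA.
    move/eqP: c0; rewrite addr_eq0 => /eqP c0.
    by rewrite -scaler_sumr -[X in _ *: X]opprK -c0 scaleNr scalerN opprK scalerA mulVf ?scale1r.
  move: c0; rewrite cz scale0r add0r => /b_free c0 i.
  by case: (unliftP ord0 i) => [j|] ->.
- rewrite inE => /orP[/eqP ->|/b_span[c ->]].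
    exists (fun i => (i == ord0)%:R).
    rewrite big_ord_recl /= scale1r big1 ?addr0 // => i _.
    by rewrite scale0r.
  exists (fun i => if unlift ord0 i is Some j then c j else 0).
  rewrite big_ord_recl /= unlift_none scale0r add0r.
  by apply: eq_bigr => i _; rewrite liftK.
Qed.

Variables (H : set V) (T : V -> V) (k : nat).
Variables (lam : 'I_k -> V -> K) (v : 'I_k -> V).
Hypothesis lam_linear :
  forall i c x y, lam i (c *: x + y) = c * lam i x + lam i y.
Hypothesis v_H : forall i, H (v i).
Hypothesis TE : forall x, H x -> T x = \sum_i lam i x *: v i.

Let lam0 i : lam i 0 = 0.
Proof.
by have := lam_linear i 1 0 0; rewrite scaler0 add0r mul1r -[LHS]addr0 => /addrI.
Qed.

Let lam_sum i (I : finType) (c : I -> K) (w : I -> V) :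
  lam i (\sum_j c j *: w j) = \sum_j c j * lam i (w j).
Proof.
elim/big_rec2: _ => [|j a b _ <-]; first exact: lam0.
exact: lam_linear.
Qed.

(** The families [u] and [v] are expressed in a common free family [b], by matrices [P] and [Q].
    Then tr A = tr (P c) = tr (c P) = tr (L Q) = tr (Q L), and the diagonal entries of Q L are the
    [lam s (v s)]. *)
Lemma is_trace_unique t : is_trace H T t -> t = \sum_i lam i (v i).
Proof.
move=> [d [u [A [[uH u_span] u_free TA ->]]]].
have [b [bs b_free b_span]] := free_subfamily (codom u ++ codom v).
have b_H (i : 'I_(size b)) : H b`_i.
  have /bs := mem_nth 0 (ltn_ord i).
  by rewrite mem_cat => /orP[]/codomP[j ->].
have [P uP] : exists P : 'M[K]_(d, size b), forall i, u i = \sum_j P i j *: b`_j.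
  have us i : in_span (fun i : 'I_(size b) => b`_i) (u i).
    by apply: b_span; rewrite mem_cat codom_f.
  have [P Ps] := choice us; exists (\matrix_(i, j) P i j) => i.
  by under eq_bigr do rewrite mxE.
have [Q vQ] : exists Q : 'M[K]_(k, size b), forall i, v i = \sum_j Q i j *: b`_j.
  have us i : in_span (fun i : 'I_(size b) => b`_i) (v i).
    by apply: b_span; rewrite mem_cat codom_f orbT.
  have [Q Qs] := choice us; exists (\matrix_(i, j) Q i j) => i.
  by under eq_bigr do rewrite mxE.
have [c bc] : exists c : 'M[K]_(size b, d), forall i : 'I_(size b), T b`_i = \sum_j c i j *: u j.
  have us (i : 'I_(size b)) := u_span _ (b_H i).
  have [c cs] := choice us; exists (\matrix_(i, j) c i j) => i.
  by under eq_bigr do rewrite mxE.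
pose L := \matrix_(i < size b, s < k) lam s b`_i.
(* Both sides hold the coordinates of [T (u i)] in the free family [u]. *)
have AE : A^T = P *m c.
  apply/matrixP => i; apply: (free_family_inj u_free).
  under eq_bigr do rewrite mxE; rewrite -TA TE // uP.
  have -> : \sum_s lam s (\sum_j P i j *: b`_j) *: v s
            = \sum_j P i j *: T b`_j.
    under eq_bigr do rewrite lam_sum scaler_suml.
    rewrite exchange_big; apply: eq_bigr => j _; rewrite TE // scaler_sumr.
    by apply: eq_bigr => s _; rewrite scalerA.
  under [RHS]eq_bigr do rewrite mxE scaler_suml.
  rewrite exchange_big; apply: eq_bigr => j _; rewrite bc scaler_sumr.
  by apply: eq_bigr => s _; rewrite scalerA.
(* Both sides hold the coordinates of [T] applied to the family [b], reached once through [u] and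
   once through [v]. *)
have cP : c *m P = L *m Q.
  apply/matrixP => i; apply: (free_family_inj b_free).
  transitivity (T b`_i).
    rewrite bc; under [RHS]eq_bigr do rewrite uP scaler_sumr.
    rewrite exchange_big; apply: eq_bigr => j _; rewrite mxE scaler_suml.
    by apply: eq_bigr => s _; rewrite scalerA.
  rewrite TE //; under eq_bigr do rewrite vQ scaler_sumr.
  rewrite exchange_big; apply: eq_bigr => j _; rewrite mxE scaler_suml.
  by apply: eq_bigr => s _; rewrite scalerA mxE.
rewrite -mxtrace_tr AE mxtrace_mulC cP mxtrace_mulC.
apply: eq_bigr => s _; rewrite [in RHS]vQ lam_sum mxE.
by apply: eq_bigr => j _; rewrite mxE.
Qed.

(** A free subfamily of [v] with the same span contains the range of [T], so some trace exists;
    [is_trace_unique] then evaluates it. *)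
Lemma is_trace_sum : is_trace H T (\sum_i lam i (v i)).
Proof.
have [b [bs b_free b_span]] := free_subfamily (codom v).
have b_H (i : 'I_(size b)) : H b`_i.
  by have /bs/codomP[j ->] := mem_nth 0 (ltn_ord i).
have [Q vQ] : exists Q : 'M[K]_(k, size b), forall i, v i = \sum_j Q i j *: b`_j.
  have us i : in_span (fun i : 'I_(size b) => b`_i) (v i).
    by apply: b_span; rewrite codom_f.
  have [Q Qs] := choice us; exists (\matrix_(i, j) Q i j) => i.
  by under eq_bigr do rewrite mxE.
have Tb x : H x -> T x = \sum_j (\sum_i lam i x * Q i j) *: b`_j.
  move=> xH; rewrite TE //; under eq_bigr do rewrite vQ scaler_sumr.
  rewrite exchange_big; apply: eq_bigr => j _; rewrite scaler_suml.
  by apply: eq_bigr => s _; rewrite scalerA.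
have tr : is_trace H T (\tr (\matrix_(i, j) (\sum_s lam s b`_j * Q s i))).
  exists (size b), (fun i => b`_i), (\matrix_(i, j) (\sum_s lam s b`_j * Q s i)).
  split=> //.
    by split=> // x xH; exists (fun j => \sum_i lam i x * Q i j); exact: Tb.
  by move=> j; rewrite Tb //; apply: eq_bigr => i _; rewrite mxE.
by rewrite -(is_trace_unique tr).
Qed.

End TraceTheory.

(** * The algebra Fun and its vacuum functional *)

Section FunTheory.
Variables (R : realType) (q : R) (m n : nat).
Local Notation C := R[i].
Local Notation qC := (q%:C%C : C).
Local Notation Fun := (Fun q m n).
Local Notation fz := (@fz R q m n).
Local Notation f0 := (@f0 R q m n).
Local Notation fstar := (@fstar R q m n).
Local Notation HU := (@HU R q m n).
Local Notation CMat := (@CMat R q m n).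

Lemma funAl (c : C) (x y : Fun) : (c *: x) * y = c *: (x * y).
Proof. by rewrite (palg_scaleAl c x y). Qed.

Lemma funAr (c : C) (x y : Fun) : x * (c *: y) = c *: (x * y).
Proof. by rewrite (palg_scaleAr c x y). Qed.

Lemma fstarD (x y : Fun) : fstar (x + y) = fstar x + fstar y.
Proof. exact: starD. Qed.

Lemma fstarM (x y : Fun) : fstar (x * y) = fstar y * fstar x.
Proof. exact: starM. Qed.

Lemma fstarZ c (x : Fun) : fstar (c *: x) = c^* *: fstar x.
Proof. exact: starZ. Qed.

Lemma fstarK : involutive fstar.
Proof. exact: starK. Qed.

Lemma fstar0 : fstar 0 = 0.
Proof. by rewrite -[0 in LHS](scale0r (0 : Fun)) fstarZ conjC0 scale0r. Qed.

Lemma fstar_sum (I : Type) (s : seq I) (P : pred I) (F : I -> Fun) :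
  fstar (\sum_(i <- s | P i) F i) = \sum_(i <- s | P i) fstar (F i).
Proof. exact: (big_morph fstar fstarD fstar0). Qed.

Lemma fun_relP t u : fun_rel q t u ->
  class_of (star_rel (fun_rel q (m := m) (n := n))) t
  = class_of (star_rel (fun_rel q (m := m) (n := n))) u.
Proof. by move=> tu; apply/class_ofP; apply: cong_rel; exact: star_rel_of. Qed.

Definition fun_clsE := (@class_ofZ _ _ (star_rel (fun_rel q (m := m) (n := n))),
  @class_ofD _ _ (star_rel (fun_rel q (m := m) (n := n))),
  @class_ofM _ _ (star_rel (fun_rel q (m := m) (n := n))),
  @class_ofC _ _ (star_rel (fun_rel q (m := m) (n := n)))).

Lemma fstar_z a al :
  fstar (fz a al) = class_of _ (tzs R a al).
Proof. exact: starE. Qed.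

Lemma f0f0 : f0 * f0 = f0.
Proof. by rewrite -[LHS]class_ofM (fun_relP (fun_f0f0 _ _ _)). Qed.

Lemma fstar_f0 : fstar f0 = f0.
Proof. by rewrite -[RHS](fun_relP (fun_f0s _ _ _)); exact: starE. Qed.

Lemma zstar_f0 a al : fstar (fz a al) * f0 = 0.
Proof.
rewrite fstar_z -[LHS]class_ofM (fun_relP (fun_zsf0 _ _ _)).
by rewrite class_ofC scale0r.
Qed.

Lemma f0_z a al : f0 * fz a al = 0.
Proof.
rewrite -[LHS]class_ofM (fun_relP (fun_f0z _ _ _)).
by rewrite class_ofC scale0r.
Qed.

Lemma z_row a (al1 al2 : 'I_m) : (al1 < al2)%N ->
  fz a al1 * fz a al2 = qC *: (fz a al2 * fz a al1).
Proof.
move=> lt_al; have := fun_relP (fun_pol (pol_row q a lt_al)).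
by rewrite !fun_clsE.
Qed.

Lemma z_col (a1 a2 : 'I_n) al : (a1 < a2)%N ->
  fz a1 al * fz a2 al = qC *: (fz a2 al * fz a1 al).
Proof.
move=> lt_a; have := fun_relP (fun_pol (pol_col q al lt_a)).
by rewrite !fun_clsE.
Qed.

Lemma z_comm (a1 a2 : 'I_n) (al1 al2 : 'I_m) : (al1 < al2)%N -> (a2 < a1)%N ->
  fz a1 al1 * fz a2 al2 = fz a2 al2 * fz a1 al1.
Proof.
move=> lt_al lt_a; have := fun_relP (fun_pol (pol_comm q lt_al lt_a)).
by rewrite !fun_clsE.
Qed.

Lemma z_cross (a1 a2 : 'I_n) (al1 al2 : 'I_m) : (al1 < al2)%N -> (a1 < a2)%N ->
  fz a1 al1 * fz a2 al2
  = fz a2 al2 * fz a1 al1 + (qC - qC^-1) *: (fz a1 al2 * fz a2 al1).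
Proof.
move=> lt_al lt_a; have := fun_relP (fun_pol (pol_cross q lt_al lt_a)).
rewrite !fun_clsE => <-.
by rewrite scaleN1r [RHS]addrC subrK.
Qed.

Lemma z_star (a b : 'I_n) (al be : 'I_m) :
  fstar (fz b be) * fz a al
  = qC ^+ 2 *: (\sum_(a' < n) \sum_(b' < n) \sum_(al' < m) \sum_(be' < m)
      (rcoef q b a b' a' * rcoef q be al be' al')
        *: (fz a' al' * fstar (fz b' be')))
    + ((1 - qC ^+ 2) * ((a == b) && (al == be))%:R) *: (1 : Fun).
Proof.
have := fun_relP (fun_pol (pol_star q a b al be)).
rewrite !fun_clsE -fstar_z => ->; congr (_ *: _ + _).
have cls_sum k (F : 'I_k -> fterm R m n) :
    class_of (star_rel (fun_rel q (m := m) (n := n)))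
      (\big[@Add _ _/Cst 0]_i F i) = \sum_i class_of _ (F i).
  apply: (big_morph _ (@class_ofD _ _ _)).
  by rewrite class_ofC scale0r.
do 4![rewrite cls_sum; apply: eq_bigr => ? _].
by rewrite !fun_clsE fstar_z.
Qed.

(** * The space [HU] as a left ideal of [Fun] *)

Lemma CMat_f0 psi : CMat psi -> exists c : C, f0 * psi = c *: f0.
Proof.
elim=> {psi}.
- by move=> a al; exists 0; rewrite f0_z scale0r.
- by exists 1; rewrite mulr1 scale1r.
- by move=> f g _ [c fc] _ [d gd]; exists (c + d); rewrite mulrDr fc gd scalerDl.
- by move=> c f _ [d fd]; exists (c * d); rewrite funAr fd scalerA.
- move=> f g _ [c fc] _ [d gd]; exists (c * d).
  by rewrite mulrA fc funAl gd scalerA.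
Qed.

Lemma HU_0 : HU 0.
Proof.
exists (0 *: (1 : Fun)); first exact/CMat_Z/CMat_1.
by rewrite scale0r mul0r.
Qed.

Lemma HU_D x y : HU x -> HU y -> HU (x + y).
Proof.
move=> [f Cf ->] [g Cg ->]; exists (f + g); first exact: CMat_D.
by rewrite mulrDl.
Qed.

Lemma HU_Z c x : HU x -> HU (c *: x).
Proof.
move=> [f Cf ->]; exists (c *: f); first exact: CMat_Z.
by rewrite funAl.
Qed.

Lemma HU_sum (I : Type) (s : seq I) (P : pred I) (F : I -> Fun) :
  (forall i, HU (F i)) -> HU (\sum_(i <- s | P i) F i).
Proof.
move=> HF; elim/big_rec: _ => [|i x _]; [exact: HU_0|exact: HU_D].
Qed.

Lemma HU_f0 : HU f0.
Proof. by exists 1; [exact: CMat_1|rewrite mul1r]. Qed.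

Lemma HU_CMat psi x : CMat psi -> HU x -> HU (psi * x).
Proof.
move=> Cp [f Cf ->]; exists (psi * f); first exact: CMat_M.
by rewrite mulrA.
Qed.

(** By [z_star], an adjoint moves to the right past each generator, at the price of other adjoints,
    until it meets [f0]. *)
Lemma HU_zstar b be x : HU x -> HU (fstar (fz b be) * x).
Proof.
move=> [psi Cpsi ->].
(* All adjoints are treated at once, because moving one produces others. Replacing [f0] by any good
   vector makes the product case compose. *)
pose good x := HU x /\ forall b be, HU (fstar (fz b be) * x).
suff [_] : good (psi * f0) by apply.
have: good f0.
  by split=> [|b' be']; [exact: HU_f0|rewrite zstar_f0; exact: HU_0].
move: (f0); elim: {x} Cpsi => [a al|||c|].
- move=> x [Hx sx]; split=> [|b' be']; first exact: HU_CMat (CMat_z _ _ _) Hx.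
  rewrite mulrA z_star mulrDl !funAl mul1r.
  apply: HU_D; last exact: HU_Z.
  apply: HU_Z; rewrite mulr_suml; apply: HU_sum => a'.
  rewrite mulr_suml; apply: HU_sum => ?; rewrite mulr_suml; apply: HU_sum => ?.
  rewrite mulr_suml; apply: HU_sum => ?; rewrite funAl -mulrA; apply: HU_Z.
  exact: HU_CMat (CMat_z _ _ _) _.
- by move=> x gx; rewrite mul1r.
- move=> f g _ IHf _ IHg x gx; have [Hf sf] := IHf x gx; have [Hg sg] := IHg x gx.
  rewrite mulrDl; split=> [|b' be']; first exact: HU_D.
  by rewrite mulrDr; exact: HU_D.
- move=> f _ IHf x gx; have [Hf sf] := IHf x gx.
  rewrite funAl; split=> [|b' be']; first exact: HU_Z.
  by rewrite funAr; exact: HU_Z.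
- by move=> f g _ IHf _ IHg x gx; rewrite -mulrA; apply/IHf/IHg.
Qed.

Lemma HU_mul (psi x : Fun) : HU x -> HU (psi * x).
Proof.
elim/palg_ind: psi x => t; elim: t => [[[a al|] []]|c|t IHt u IHu|t IHt u IHu] x Hx.
- by rewrite -[class_of _ _]/(class_of _ (tzs R a al)) -fstar_z; exact: HU_zstar.
- exact: HU_CMat (CMat_z _ _ _) Hx.
- rewrite -[class_of _ _]/(class_of _ (tf0s R m n)) (fun_relP (fun_f0s _ _ _)).
  have [psi Cpsi ->] := Hx; have [c fc] := CMat_f0 Cpsi.
  by rewrite mulrA fc funAl f0f0; apply/HU_Z/HU_f0.
- have [psi Cpsi ->] := Hx; have [c fc] := CMat_f0 Cpsi.
  rewrite -[class_of _ _]/f0.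
  by rewrite mulrA fc funAl f0f0; apply/HU_Z/HU_f0.
- by rewrite class_ofC funAl mul1r; exact: HU_Z.
- by rewrite class_ofD mulrDl; apply: HU_D; [exact: IHt|exact: IHu].
- by rewrite class_ofM -mulrA; exact/IHt/IHu.
Qed.

Lemma HU_mulf0 psi : HU (psi * f0).
Proof. exact/HU_mul/HU_f0. Qed.

Lemma HU_f0r x : HU x -> x * f0 = x.
Proof. by move=> [psi _ ->]; rewrite -mulrA f0f0. Qed.

(** Once [x * f0] is rewritten as [psi * f0] with [psi] in [CMat], only the constant term of [psi]
    survives, since [f0] kills every generator to its right. *)
Lemma f0_x_f0 x : exists c : C, f0 * x * f0 = c *: f0.
Proof.
have [psi Cpsi xE] := HU_mulf0 x; have [c fc] := CMat_f0 Cpsi.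
by exists c; rewrite -mulrA xE mulrA fc funAl f0f0.
Qed.

(* The condition for [f0 = 0] makes [vac] linear in all cases. *)
Definition vac (x : Fun) : C :=
  xget 0 [set c | f0 * x * f0 = c *: f0 /\ (f0 = 0 -> c = 0)].

Lemma vac_spec x : f0 * x * f0 = vac x *: f0 /\ (f0 = 0 -> vac x = 0).
Proof.
have [c xc] := f0_x_f0 x; rewrite /vac.
case: xgetP => [d _ //|/(_ (if f0 == 0 then 0 else c)) []].
split=> [|f0_0]; last by rewrite f0_0 eqxx.
by case: eqVneq => // ->; rewrite scaler0 mulr0.
Qed.

Lemma vacE x : f0 * x * f0 = vac x *: f0.
Proof. by case: (vac_spec x). Qed.

(** Lets scalars be compared through [f0] without knowing that [f0] is non-zero. *)
Lemma scalef0_inj (c d : C) : (f0 = 0 -> c = d) -> c *: f0 = d *: f0 -> c = d.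
Proof.
move=> cd /eqP; rewrite -subr_eq0 -scalerBl scaler_eq0 => /orP[|/eqP /cd//].
by rewrite subr_eq0 => /eqP.
Qed.

Lemma vac_val x c : f0 * x * f0 = c *: f0 -> (f0 = 0 -> c = 0) -> vac x = c.
Proof.
have [xE x0] := vac_spec x => xc c0.
by apply: scalef0_inj => [f00|]; [rewrite x0 // c0|rewrite -xE xc].
Qed.

Lemma vac_linear c x y : vac (c *: x + y) = c * vac x + vac y.
Proof.
apply: vac_val => [|f00].
  by rewrite mulrDr mulrDl funAr funAl !vacE scalerA scalerDl.
by rewrite !(vac_spec _).2 // mulr0 addr0.
Qed.

Lemma vac0 : vac 0 = 0.
Proof. by apply: vac_val => //; rewrite mulr0 mul0r scale0r. Qed.

Lemma vacD x y : vac (x + y) = vac x + vac y.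
Proof. by rewrite -[x in LHS]scale1r vac_linear mul1r. Qed.

Lemma vacZ c x : vac (c *: x) = c * vac x.
Proof. by rewrite -[c *: x]addr0 vac_linear vac0 addr0. Qed.

Lemma vac_f0r x : vac (x * f0) = vac x.
Proof. by apply: vac_val (vac_spec x).2; rewrite mulrA -[LHS]mulrA f0f0 vacE. Qed.

Lemma vac_f0 : f0 <> 0 -> vac f0 = 1.
Proof. by move=> f00; apply: vac_val => //; rewrite !f0f0 scale1r. Qed.

End FunTheory.

(** * Invariance of the integral *)

Section ExpHRho.
Variables (R : realType) (q : R) (N : nat).
Hypothesis q_neq0 : q != 0.
Local Notation C := R[i].
Local Notation qC := (q%:C%C : C).
Local Notation Uq := (Uq q N).
Local Notation uE := (@uE R q N).
Local Notation uF := (@uF R q N).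
Local Notation uK := (@uK R q N).
Local Notation uKinv := (@uKinv R q N).
Local Notation rho := (exp_hrho q N).

Lemma qC_neq0 : qC != 0.
Proof. by rewrite -(rmorph0 (real_complex R)) (inj_eq (@complexI _)). Qed.

Lemma uqAl (c : C) (x y : Uq) : (c *: x) * y = c *: (x * y).
Proof. by rewrite (palg_scaleAl c x y). Qed.

Lemma uqAr (c : C) (x y : Uq) : x * (c *: y) = c *: (x * y).
Proof. by rewrite (palg_scaleAr c x y). Qed.

(* The exponents k (N - k) have second difference -2 and vanish at 0 and N. *)
Lemma cartan_sum (i : 'I_N.-1) :
  \sum_(j < N.-1) cartan i j * (j.+1 * (N - j.+1))%N%:Z = 2.
Proof.
pose e (j : nat) : int := (j.+1 * (N - j.+1))%N%:Z.
(* [d] extends [e] by 0 beyond the last node. The lower neighbour needs a guard below, because the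
   predecessor of 0 is 0. *)
pose d (k : nat) : int := \sum_(j < N.-1 | j == k :> nat) e j.
have dE k : d k = if (k < N.-1)%N then e k else 0 by rewrite /d big_ord1_eq.
have -> : \sum_(j < N.-1) cartan i j * (j.+1 * (N - j.+1))%N%:Z
          = 2 * d i - (if (i > 0)%N then d i.-1 else 0) - d i.+1.
  have -> : (if (i > 0)%N then d i.-1 else 0)
            = \sum_(j < N.-1 | j.+1 == i :> nat) e j.
    case: (val i) => [|k] /=; first by rewrite big_pred0.
    by apply: eq_bigl => j; rewrite eqSS.
  have mk (P : pred 'I_N.-1) :
    \sum_(j < N.-1 | P j) e j = \sum_(j < N.-1) (P j)%:R * e j.
    rewrite big_mkcond; apply: eq_bigr => j _.
    by case: (P j); rewrite ?mul1r ?mul0r.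
  rewrite /d !mk mulr_sumr -!sumrB; apply: eq_bigr => j _.
  rewrite /cartan /adjacent -/(e j) -val_eqE /=; move: (e j) => x.
  by do 4![case: eqP => ? /=]; lia.
rewrite !dE ltn_ord /e; case: i => i /= lt_i.
have [k ->] : exists k, N = (i + k).+2 by exists (N - i.+2)%N; lia.
case: i lt_i => [|i] lt_i /=; do ?case: ifP => ?; nia.
Qed.

Lemma mul_exp_hrho (x : Uq) (c : 'I_N.-1 -> int) :
  (forall j, x * uKinv j = qC ^ c j *: (uKinv j * x)) ->
  x * rho = qC ^ (\sum_j c j * (j.+1 * (N - j.+1))%N%:Z) *: (rho * x).
Proof.
move=> xK; rewrite /exp_hrho.
elim/big_rec2: _ => [|j p z _ IH]; first by rewrite expr0z scale1r mulr1 mul1r.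
have xKn k : x * uKinv j ^+ k = qC ^ (c j * k%:Z) *: (uKinv j ^+ k * x).
  elim: k => [|k IHk]; first by rewrite mulr0 expr0z scale1r !expr0 mulr1 mul1r.
  rewrite exprSr mulrA IHk uqAl -mulrA xK uqAr scalerA -expfzDr ?qC_neq0 //.
  by rewrite mulrA -exprSr; congr (_ ^ _ *: _); lia.
rewrite mulrA xKn uqAl -mulrA IH uqAr scalerA -expfzDr ?qC_neq0 //.
by rewrite mulrA.
Qed.

(** With the next two lemmas, this says that conjugation by [rho] agrees with the square of the
    antipode on generators, as a quantum trace requires. *)
Lemma uE_exp_hrho i : uE i * rho = qC ^ 2 *: (rho * uE i).
Proof. by rewrite (mul_exp_hrho (uEKinvC q i)) cartan_sum. Qed.

Lemma uF_exp_hrho i : uF i * rho = qC ^ (-2) *: (rho * uF i).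
Proof.
rewrite (mul_exp_hrho (uFKinvC q i)).
under eq_bigr do rewrite mulNr.
by rewrite sumrN cartan_sum.
Qed.

Lemma uK_exp_hrho i : uK i * rho = rho * uK i.
Proof.
rewrite (@mul_exp_hrho _ (fun => 0)).
  by rewrite big1 ?expr0z ?scale1r // => j _; rewrite mul0r.
by move=> j; rewrite expr0z scale1r uKKinvC.
Qed.

End ExpHRho.

(** * The trace formula, and invariance generator by generator *)

Section Invariance.
Variables (R : realType) (q : R) (m n : nat).
Hypotheses (q_gt0 : 0 < q) (m_gt0 : (0 < m)%N) (n_gt0 : (0 < n)%N).
Variable act : Uq q (m + n) -> Fun q m n -> Fun q m n.
Hypotheses (act_cov : covariant act) (act_gen : fun_action act).
Local Notation C := R[i].
Local Notation qC := (q%:C%C : C).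
Local Notation Fun := (Fun q m n).
Local Notation fz := (@fz R q m n).
Local Notation f0 := (@f0 R q m n).
Local Notation uE := (@uE R q (m + n)).
Local Notation uF := (@uF R q (m + n)).
Local Notation uK := (@uK R q (m + n)).
Local Notation uKinv := (@uKinv R q (m + n)).
Local Notation rho := (exp_hrho q (m + n)).
Local Notation HU := (@HU R q m n).
Local Notation DU := (@DU R q m n).

Let q_neq0 : q != 0. Proof. exact: lt0r_neq0. Qed.

Lemma actD x f g : act x (f + g) = act x f + act x g.
Proof. by rewrite -[f in LHS]scale1r act_linearr // scale1r. Qed.

Lemma act0 x : act x 0 = 0.
Proof. by apply: (addrI (act x 0)); rewrite -actD !addr0. Qed.

Lemma actZ x c f : act x (c *: f) = c *: act x f.
Proof. by rewrite -[c *: f]addr0 act_linearr // act0 addr0. Qed.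

Lemma act_sum x (I : Type) (s : seq I) (P : pred I) (F : I -> Fun) :
  act x (\sum_(i <- s | P i) F i) = \sum_(i <- s | P i) act x (F i).
Proof. exact: (big_morph (act x) (actD x) (act0 x)). Qed.

Lemma actDl x y f : act (x + y) f = act x f + act y f.
Proof. by rewrite -[x in LHS]scale1r act_linearl // scale1r. Qed.

Lemma act0l f : act 0 f = 0.
Proof. by apply: (addrI (act 0 f)); rewrite -actDl !addr0. Qed.

Lemma actZl c x f : act (c *: x) f = c *: act x f.
Proof. by rewrite -[c *: x]addr0 act_linearl // act0l addr0. Qed.

Lemma act_uE i f g :
  act (uE i) (f * g) = act (uE i) f * g + act (uK i) f * act (uE i) g.
Proof. by rewrite act_coprod // !big_cons big_nil addr0 /= act_unit. Qed.

Lemma act_uF i f g :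
  act (uF i) (f * g) = act (uF i) f * act (uKinv i) g + f * act (uF i) g.
Proof. by rewrite act_coprod // !big_cons big_nil addr0 /= act_unit. Qed.

Lemma act_uK i f g : act (uK i) (f * g) = act (uK i) f * act (uK i) g.
Proof. by rewrite act_coprod // !big_cons big_nil addr0. Qed.

Lemma act_uKinv i f g :
  act (uKinv i) (f * g) = act (uKinv i) f * act (uKinv i) g.
Proof. by rewrite act_coprod // !big_cons big_nil addr0. Qed.

Lemma act_uK_uKinv i f : act (uK i) (act (uKinv i) f) = f.
Proof. by rewrite -act_mul // uKKinv act_unit. Qed.

Lemma act_uKinv_uK i f : act (uKinv i) (act (uK i) f) = f.
Proof. by rewrite -act_mul // uKinvK act_unit. Qed.

(** At the [n]-th node, [E_j f0] is a multiple of $z f_0$ and [F_j f0] of $f_0 z^*$; elsewhere both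
    vanish. These one-sided identities let all nodes be treated alike. *)
Lemma act_gens_f0 j :
  [/\ act (uK j) f0 = f0, act (uKinv j) f0 = f0,
      f0 * act (uE j) f0 = 0 /\ act (uE j) f0 * f0 = act (uE j) f0
    & act (uF j) f0 * f0 = 0 /\ f0 * act (uF j) f0 = act (uF j) f0].
Proof.
have [jn|jn] := eqVneq j.+1 n; last first.
  by have [-> -> -> ->] := act_f0 act_gen jn; rewrite !(mulr0, mul0r).
have a_lt : (n.-1 < n)%N by rewrite prednK.
have al_lt : (m.-1 < m)%N by rewrite prednK.
have [-> -> -> ->] := act_f0_mid act_gen (a' := Ordinal a_lt)
  (al' := Ordinal al_lt) jn (prednK n_gt0) (prednK m_gt0).
split=> //; split; rewrite ?funAr ?funAl.
- by rewrite mulrA f0_z mul0r scaler0.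
- by rewrite -mulrA f0f0.
- by rewrite -mulrA zstar_f0 mulr0 scaler0.
- by rewrite mulrA f0f0.
Qed.

Lemma act_uK_f0 j : act (uK j) f0 = f0.
Proof. by case: (act_gens_f0 j). Qed.

Lemma act_uKinv_f0 j : act (uKinv j) f0 = f0.
Proof. by case: (act_gens_f0 j). Qed.

(** Transfers to [rho] what holds for each [uKinv j] and survives products: multiplicativity, fixing
    [f0], positive eigenvalues. *)
Lemma act_rho_ind (P : (Fun -> Fun) -> Prop) :
  (forall u v, P (act u) -> P (act v) -> P (act (u * v))) ->
  P (act 1) -> (forall j, P (act (uKinv j))) -> P (act rho).
Proof.
move=> PM P1 PK; rewrite /exp_hrho; elim/big_rec: _ => // j x _ Px.
apply: (PM) => //; elim: (_ * _)%N => [|k IHk]; first by rewrite expr0.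
by rewrite exprS; exact: PM.
Qed.

Lemma act_rhoM f g : act rho (f * g) = act rho f * act rho g.
Proof.
move: f g; apply: (act_rho_ind (P := fun u => forall f g, u (f * g) = u f * u g)).
- by move=> u v Hu Hv f g; rewrite !act_mul // Hv Hu.
- by move=> f g; rewrite !act_unit.
- exact: act_uKinv.
Qed.

Lemma act_rho_f0 : act rho f0 = f0.
Proof.
apply: (act_rho_ind (P := fun u => u f0 = f0)).
- by move=> u v Hu Hv; rewrite !act_mul // Hv Hu.
- by rewrite !act_unit.
- exact: act_uKinv_f0.
Qed.

Lemma DU_sum (s : seq (Fun * Fun)) : DU (\sum_(p <- s) p.1 * f0 * p.2).
Proof. by exists s. Qed.

(** Since x = x f0, the factor f0 b x f0 collapses to a multiple of f0, so each summand has rank at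
    most one. *)
Lemma Theta_DU (s : seq (Fun * Fun)) (x : Fun) : HU x ->
  Theta (\sum_(p <- s) p.1 * f0 * p.2) x
  = \sum_(p <- s) vac (p.2 * x) *: (p.1 * f0).
Proof.
move=> Hx; rewrite /Theta mulr_suml; apply: eq_bigr => p _.
by rewrite -{1}(HU_f0r Hx) -funAr -vacE !mulrA.
Qed.

Lemma HU_rho x : HU x -> HU (act rho x).
Proof.
by move=> [psi _ ->]; rewrite act_rhoM act_rho_f0; exact: HU_mulf0.
Qed.

Lemma finite_rank_Theta f : DU f -> finite_rank HU (Theta f).
Proof.
move=> [s ->]; split=> [x Hx|]; first exact: HU_mul.
exists (size s), (fun i => (s`_i).1 * f0); split=> [i|x Hx].
  exact: HU_mulf0.
exists (fun i => vac ((s`_i).2 * x)); rewrite Theta_DU //.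
by rewrite (big_nth 0) big_mkord.
Qed.

(** The trace results apply with functionals vac(b rho(x)) and vectors a f0. In particular the sum
    does not depend on how the element of [DU] is decomposed. *)
Lemma is_trace_nu (s : seq (Fun * Fun)) t :
  is_trace HU (nu_operator act (\sum_(p <- s) p.1 * f0 * p.2)) t
  <-> t = \sum_(p <- s) vac (p.2 * act rho p.1).
Proof.
pose lam (i : 'I_(size s)) x := vac ((s`_i).2 * act rho x).
pose v (i : 'I_(size s)) := (s`_i).1 * f0.
have lam_lin i c x y : lam i (c *: x + y) = c * lam i x + lam i y.
  by rewrite /lam act_linearr // mulrDr funAr vac_linear.
have v_H i : HU (v i) by exact: HU_mulf0.
have TE x : HU x -> nu_operator act (\sum_(p <- s) p.1 * f0 * p.2) x
            = \sum_i lam i x *: v i.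
  move=> Hx; rewrite /nu_operator /Gamma /= Theta_DU; last exact: HU_rho.
  by rewrite (big_nth 0) big_mkord.
have -> : \sum_(p <- s) vac (p.2 * act rho p.1) = \sum_i lam i (v i).
  rewrite (big_nth 0) big_mkord; apply: eq_bigr => i _.
  by rewrite /lam /v act_rhoM act_rho_f0 mulrA vac_f0r.
split=> [|->]; first exact: is_trace_unique.
exact: is_trace_sum.
Qed.

Lemma integralE (s : seq (Fun * Fun)) :
  integral act (\sum_(p <- s) p.1 * f0 * p.2)
  = \sum_(p <- s) vac (p.2 * act rho p.1).
Proof.
rewrite /integral /trace; case: xgetP => [t _ /is_trace_nu //|].
by move/(_ (\sum_(p <- s) vac (p.2 * act rho p.1)))/is_trace_nu.
Qed.

Lemma integral_linear c f g : DU f -> DU g ->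
  DU (c *: f + g) /\
  integral act (c *: f + g) = c * integral act f + integral act g.
Proof.
move=> [s ->] [t ->].
have -> : c *: (\sum_(p <- s) p.1 * f0 * p.2) + \sum_(p <- t) p.1 * f0 * p.2
    = \sum_(p <- [seq (c *: p.1, p.2) | p <- s] ++ t) p.1 * f0 * p.2.
  rewrite big_cat big_map scaler_sumr /=; congr (_ + _).
  by apply: eq_bigr => p _; rewrite !funAl.
split; first exact: DU_sum.
rewrite !integralE big_cat big_map mulr_sumr /=; congr (_ + _).
by apply: eq_bigr => p _; rewrite actZ funAr vacZ.
Qed.

Lemma vac_uK j x : vac (act (uK j) x) = vac x.
Proof.
apply: vac_val (vac_spec x).2.
transitivity (act (uK j) (f0 * x * f0)).
  by rewrite !act_uK !act_uK_f0.
by rewrite vacE actZ act_uK_f0.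
Qed.

Lemma vac_uK_mul j x y : vac (act (uK j) x * y) = vac (x * act (uKinv j) y).
Proof. by rewrite -[RHS](vac_uK j) act_uK act_uK_uKinv. Qed.

(** Apply E_j to f0 x f0 = vac(x) f0 and multiply by f0 on the left: every term in which E_j f0
    directly follows f0 disappears. *)
Lemma vac_uE j x : vac (act (uE j) x) = - vac (act (uK j) x * act (uE j) f0).
Proof.
have [Kf0 _ [fE Ef] _] := act_gens_f0 j.
apply: vac_val => [|f00]; last by rewrite (vac_spec _).2 // oppr0.
have : f0 * act (uE j) (f0 * x * f0) = 0.
  by rewrite vacE actZ funAr fE scaler0.
rewrite act_uE act_uE act_uK Kf0 mulrDl !mulrDr !mulrA fE !mul0r add0r f0f0.
move/eqP; rewrite addr_eq0 => /eqP ->.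
by rewrite scaleNr -vacE -!mulrA Ef.
Qed.

(** The mirror argument: multiplication by f0 is now on the right, the side on which it kills F_j
    f0. *)
Lemma vac_uF j x : vac (act (uF j) x) = - vac (act (uF j) f0 * act (uKinv j) x).
Proof.
have [_ Kf0 _ [Ff fF]] := act_gens_f0 j.
apply: vac_val => [|f00]; last by rewrite (vac_spec _).2 // oppr0.
have : act (uF j) (f0 * x * f0) * f0 = 0.
  by rewrite vacE actZ funAl Ff scaler0.
rewrite act_uF act_uF Kf0 !mulrDl -!mulrA Ff !mulr0 addr0 f0f0.
move/eqP; rewrite addrC addr_eq0 mulrA => /eqP ->.
by rewrite scaleNr -vacE !mulrA fF.
Qed.

(** Stability of [DU] is carried along because invariance under a product applies one factor to the
    image under the other. *)
Definition invariant_under (xi : Uq q (m + n)) :=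
  forall f, DU f -> DU (act xi f)
    /\ integral act (act xi f) = counit xi * integral act f.

Lemma invariant_gen xi (g : Fun * Fun -> seq (Fun * Fun)) :
  (forall p, act xi (p.1 * f0 * p.2) = \sum_(r <- g p) r.1 * f0 * r.2) ->
  (forall p, \sum_(r <- g p) vac (r.2 * act rho r.1)
             = counit xi * vac (p.2 * act rho p.1)) ->
  invariant_under xi.
Proof.
move=> gE gI f [s ->].
have -> : act xi (\sum_(p <- s) p.1 * f0 * p.2)
          = \sum_(r <- flatten (map g s)) r.1 * f0 * r.2.
  rewrite act_sum big_flatten big_map.
  by apply: eq_bigr => p _; rewrite gE.
split; first exact: DU_sum.
rewrite !integralE big_flatten big_map mulr_sumr.
by apply: eq_bigr => p _; rewrite gI.
Qed.

Lemma invariant_uK j : invariant_under (uK j).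
Proof.
apply: (@invariant_gen _ (fun p => [:: (act (uK j) p.1, act (uK j) p.2)])).
  by move=> [a b]; rewrite big_seq1 /= !act_uK act_uK_f0.
move=> [a b]; rewrite big_seq1 /= counitE mul1r vac_uK_mul -!act_mul //.
by rewrite -!mulrA -uK_exp_hrho // mulrA uKinvK mul1r.
Qed.

Lemma invariant_uKinv j : invariant_under (uKinv j).
Proof.
apply: (@invariant_gen _ (fun p => [:: (act (uKinv j) p.1, act (uKinv j) p.2)])).
  by move=> [a b]; rewrite big_seq1 /= !act_uKinv act_uKinv_f0.
move=> [a b]; rewrite big_seq1 /= counitE mul1r -(vac_uK j) act_uK act_uK_uKinv.
by rewrite -!act_mul // -!mulrA mulrA uK_exp_hrho // -mulrA uKKinv mulr1.
Qed.

Lemma invariant_uE j : invariant_under (uE j).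
Proof.
have [Kf0 Kif0 [fE Ef] _] := act_gens_f0 j.
(* The Leibniz expansion; the middle term takes the form x f0 y because E_j f0 = (E_j f0) f0. *)
apply: (@invariant_gen _ (fun p => [:: (act (uE j) p.1, p.2);
   (act (uK j) p.1 * act (uE j) f0, p.2); (act (uK j) p.1, act (uE j) p.2)])).
  move=> [a b]; rewrite !big_cons big_nil addr0 /= -mulrA act_uE act_uE Kf0.
  by rewrite mulrDr !mulrA -(mulrA _ (act _ f0) f0) Ef.
move=> [a b]; rewrite !big_cons big_nil addr0 /= counitE mul0r.
set c := act rho (act (uK j) a).
(* With this [c], the Leibniz term vac((E_j b) c) is exactly the third summand of the goal; the next
   two rewrites identify the others. *)
have := vac_uE j (b * c).
rewrite act_uE vacD act_uK -mulrA !vac_uK_mul act_uKinv act_uKinv_uK.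
have -> : act (uKinv j) (act (uE j) c) = act rho (act (uE j) a).
  rewrite /c -!act_mul // -!mulrA (mulrA (uE j)) uE_exp_hrho // uqAl.
  rewrite -!mulrA uEKC // !uqAr scalerA /cartan eqxx -expfzDr ?qC_neq0 //.
  rewrite subrr expr0z scale1r (mulrA rho) -uK_exp_hrho // -mulrA.
  by rewrite (mulrA (uKinv j)) uKinvK mul1r.
(* Both [rho] and [uKinv j] fix f0, hence both multiply E_j f0 by $q^{-2}$. *)
have -> : act rho (act (uK j) a * act (uE j) f0)
          = c * act (uKinv j) (act (uE j) f0).
  rewrite act_rhoM; congr (_ * _); rewrite -!act_mul //.
  apply: (@scalerI _ _ (qC ^ 2)); first by rewrite expfz_neq0 ?qC_neq0.
  rewrite -!actZl -uE_exp_hrho //.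
  have -> : qC ^ 2 *: (uKinv j * uE j) = uE j * uKinv j.
    by rewrite uEKinvC // /cartan eqxx.
  by rewrite !act_mul // act_rho_f0 Kif0.
by move=> /eqP; rewrite -addr_eq0 => /eqP <-; rewrite addrA addrC addrA.
Qed.

Lemma invariant_uF j : invariant_under (uF j).
Proof.
have [Kf0 Kif0 _ [Ff fF]] := act_gens_f0 j.
apply: (@invariant_gen _ (fun p => [:: (act (uF j) p.1, act (uKinv j) p.2);
   (p.1, act (uF j) f0 * act (uKinv j) p.2); (p.1, act (uF j) p.2)])).
  move=> [a b]; rewrite !big_cons big_nil addr0 /= -mulrA !act_uF act_uKinv Kif0.
  by rewrite mulrDr !mulrA -(mulrA a f0 (act (uF j) f0)) fF !addrA.
move=> [a b]; rewrite !big_cons big_nil addr0 /= counitE mul0r.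
(* Here [uK j] is outermost, so that the [uKinv j] in the coproduct of F_j cancels it and leaves
   [act rho a]. *)
set c := act (uK j) (act rho a).
have := vac_uF j (b * c).
rewrite act_uF vacD act_uKinv act_uKinv_uK.
have -> : vac (act (uKinv j) b * act rho (act (uF j) a))
          = vac (b * act (uF j) c).
  rewrite -(vac_uK j) act_uK act_uK_uKinv; congr (vac (b * _)).
  rewrite /c -!act_mul // -!mulrA (mulrA (uF j)) uFKC // uqAl -mulrA.
  rewrite uF_exp_hrho // uqAr scalerA /cartan eqxx -expfzDr ?qC_neq0 //.
  by rewrite subrr expr0z scale1r.
by move=> /eqP; rewrite -addr_eq0 mulrA => /eqP <-; rewrite addrA addrC addrA.
Qed.

Lemma integral_invariant xi : invariant_under xi.
Proof.
elim/palg_ind: xi => t; elim: t => [[]j|c|t IHt u IHu|t IHt u IHu].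
- exact: invariant_uE.
- exact: invariant_uF.
- exact: invariant_uK.
- exact: invariant_uKinv.
- move=> f Df; rewrite counitE class_ofC actZl act_unit //=.
  have := @integral_linear c f 0 Df (ex_intro _ [::] _).
  rewrite addr0 big_nil => /(_ erefl) [? ->]; split=> //.
  have := integralE [::]; rewrite !big_nil => ->.
  by rewrite addr0.
- move=> f Df; rewrite counitE class_ofD actDl /=.
  have [Dt It] := IHt f Df; have [Du Iu] := IHu f Df.
  have [] := integral_linear 1 Dt Du.
  by rewrite scale1r mul1r It Iu !counitE -mulrDl.
- move=> f Df; rewrite counitE class_ofM act_mul //=.
  have [Du Iu] := IHu f Df; have [Dtu ->] := IHt _ Du.
  by rewrite Iu !counitE mulrA.
Qed.

End Invariance.

(** * An orthogonal monomial basis and positivity *)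

Section Fock.
Variables (R : realType) (q : R) (m n : nat).
Hypotheses (q_gt0 : 0 < q) (q_lt1 : q < 1) (m_gt0 : (0 < m)%N) (n_gt0 : (0 < n)%N).
Local Notation C := R[i].
Local Notation qC := (q%:C%C : C).
Local Notation Fun := (Fun q m n).
Local Notation fz := (@fz R q m n).
Local Notation f0 := (@f0 R q m n).
Local Notation fstar := (@fstar R q m n).
Local Notation HU := (@HU R q m n).
Local Notation DU := (@DU R q m n).
Local Notation CMat := (@CMat R q m n).

(* The generators in lexicographic order: p = a m + alpha. *)
Definition zn (p : nat) : Fun :=
  fz (Ordinal (ltn_pmod (p %/ m) n_gt0)) (Ordinal (ltn_pmod p m_gt0)).

Lemma znE (a : 'I_n) (al : 'I_m) : zn (a * m + al) = fz a al.
Proof.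
rewrite /zn; congr fz; apply: val_inj => /=.
  by rewrite divnMDl // divn_small // addn0 modn_small.
by rewrite modnMDl modn_small.
Qed.

Lemma zn_ex p : (p < n * m)%N ->
  exists (a : 'I_n) (al : 'I_m), p = (a * m + al)%N /\ zn p = fz a al.
Proof.
move=> lt_p; have lt_a : (p %/ m < n)%N by rewrite ltn_divLR.
exists (Ordinal lt_a), (Ordinal (ltn_pmod p m_gt0)).
by rewrite -znE /= -divn_eq.
Qed.

Lemma idx_lt (a : 'I_n) (al : 'I_m) : (a * m + al < n * m)%N.
Proof. by case: a al => a ? [al ?] /=; nia. Qed.

Lemma idx_eq (a b : 'I_n) (al be : 'I_m) :
  (b * m + be == a * m + al)%N = (a == b) && (al == be).
Proof.
apply/eqP/andP => [ab|[/eqP-> /eqP->] //]; split; apply/eqP/val_inj => /=.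
  have := congr1 (divn^~ m) ab.
  by rewrite /= !divnMDl // !divn_small // !addn0.
have := congr1 (modn^~ m) ab.
by rewrite /= !modnMDl !modn_small.
Qed.

(** A correction arises only when row and column both increase. Its factors are the other two
    corners of the rectangle, both before [g]; otherwise [c'] is 0. *)
Lemma zn_straighten h g : (h < g)%N -> (g < n * m)%N ->
  exists (c c' : C) (u v : nat), [/\ (u < g)%N, (v < g)%N
    & zn h * zn g = c *: (zn g * zn h) + c' *: (zn u * zn v)].
Proof.
move=> hg gnm; have [a2 [al2 [gE ->]]] := zn_ex gnm.
have [a1 [al1 [hE ->]]] := zn_ex (ltn_trans hg gnm).
have le_a : (a1 <= a2)%N by have := ltn_ord al1; have := ltn_ord al2; nia.
have triv (c : C) : fz a1 al1 * fz a2 al2 = c *: (fz a2 al2 * fz a1 al1) ->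
    exists (c c' : C) (u v : nat), [/\ (u < g)%N, (v < g)%N
      & fz a1 al1 * fz a2 al2
        = c *: (fz a2 al2 * fz a1 al1) + c' *: (zn u * zn v)].
  by move=> ->; exists c, 0, h, h; rewrite scale0r addr0.
move: le_a; rewrite leq_eqVlt => /orP[/eqP/val_inj a12|a12].
  subst a2; have al12 : (al1 < al2)%N by nia.
  exact/triv/z_row.
have [al12|al12|/val_inj al12] := ltngtP al1 al2.
- rewrite (z_cross _ al12 a12); exists 1, (qC - qC^-1).
  exists (a1 * m + al2)%N, (a2 * m + al1)%N; rewrite !znE scale1r.
  by have := ltn_ord al2; split=> //; nia.
- by apply: (triv 1); rewrite scale1r (z_comm _ al12 a12).
- by subst al2; exact/triv/z_col.
Qed.

(** Used for rows and for columns, this triangularity makes the index of an adjoint grow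
    lexicographically. *)
Lemma rcoef_neq0 b a b' a' : rcoef q b a b' a' != 0 ->
  (b' = b /\ a' = a) \/ (b < b')%N.
Proof.
rewrite /rcoef; case: ifP => [/and3P[_ /eqP-> /eqP->]|_]; first by left.
case: ifP => [/and3P[/eqP-> /eqP<- /eqP<-]|_]; first by left.
case: ifP => [/and3P[/eqP<- /eqP-> ?]|_]; first by right.
by rewrite eqxx.
Qed.

Lemma rcoef_diag a : rcoef q a a a a = 1.
Proof. by rewrite /rcoef !eqxx. Qed.

(* Only [z_h'^*] with [h' >= h] occur when [z_h^*] is moved past [z_g]. *)
Lemma zstar_step h g x : (h < n * m)%N -> (g < n * m)%N ->
  (forall h', (h < h' < n * m)%N -> fstar (zn h') * x = 0) ->
  exists c : C, (h = g -> c = qC ^+ 2) /\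
    fstar (zn h) * (zn g * x)
    = c *: (zn g * (fstar (zn h) * x)) + ((1 - qC ^+ 2) * (h == g)%:R) *: x.
Proof.
move=> /zn_ex[b [be [hE ->]]] /zn_ex[a [al [gE ->]]] x0.
exists (qC ^+ 2 * (rcoef q b a b a * rcoef q be al be al)); split.
  move/eqP; rewrite hE gE idx_eq => /andP[/eqP-> /eqP->].
  by rewrite !rcoef_diag !mulr1.
rewrite hE gE idx_eq.
rewrite mulrA z_star mulrDl !funAl mul1r; congr (_ + _).
rewrite -scalerA; congr (_ *: _).
pose t (a' b' : 'I_n) (al' be' : 'I_m) := (rcoef q b a b' a' * rcoef q be al be' al')
  *: (fz a' al' * (fstar (fz b' be') * x)).
(* An off-diagonal term with non-zero coefficient carries an adjoint of index above [h], which kills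
   [x]. *)
have t0 a' b' al' be' :
    ~~ [&& a' == a, b' == b, al' == al & be' == be] -> t a' b' al' be' = 0.
  move=> ne; rewrite /t.
  have [->|] := eqVneq (rcoef q b a b' a') 0; first by rewrite mul0r scale0r.
  have [->|] := eqVneq (rcoef q be al be' al') 0; first by rewrite mulr0 scale0r.
  move=> /rcoef_neq0 r2 /rcoef_neq0 r1.
  rewrite -(znE b' be') x0 ?mulr0 ?scaler0 //.
  rewrite idx_lt andbT hE; move: ne; rewrite -!val_eqE /=.
  have := ltn_ord be; have := ltn_ord be'; nia.
rewrite mulr_suml (bigD1 a) //= [X in _ + X]big1 => [|a' ne]; last first.
  rewrite mulr_suml big1 // => b' _; rewrite mulr_suml big1 // => al' _.
  rewrite mulr_suml big1 // => be' _; rewrite funAl -mulrA.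
  by apply: t0; rewrite (negPf ne).
rewrite mulr_suml (bigD1 b) //= [X in _ + X + _]big1 => [|b' ne]; last first.
  rewrite mulr_suml big1 // => al' _.
  rewrite mulr_suml big1 // => be' _; rewrite funAl -mulrA.
  by apply: t0; rewrite (negPf ne) andbF.
rewrite mulr_suml (bigD1 al) //= [X in _ + X + _ + _]big1 => [|al' ne]; last first.
  rewrite mulr_suml big1 // => be' _; rewrite funAl -mulrA.
  by apply: t0; rewrite (negPf ne) !andbF.
rewrite mulr_suml (bigD1 be) //= [X in _ + X + _ + _ + _]big1 => [|be' ne].
  by rewrite !addr0 funAl -mulrA.
by rewrite funAl -mulrA; apply: t0; rewrite (negPf ne) !andbF.
Qed.

(* [kap] lists the exponents from the largest generator, of index
   [(size kap).-1], down to the one of index 0. *)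
Fixpoint mon (kap : seq nat) : Fun :=
  if kap is k :: kap' then zn (size kap') ^+ k * mon kap' else f0.

(** All generators in the monomial come before [h], so no inhomogeneous term appears and the adjoint
    reaches [f0]. The induction keeps [h] general because [zstar_step] needs the claim for larger
    indices. *)
Lemma mon_zstar kap h : (size kap <= h < n * m)%N -> fstar (zn h) * mon kap = 0.
Proof.
elim: kap h => [|k kap IH] h /andP[le_h lt_h]; first exact: zstar_f0.
elim: k h le_h lt_h => [|k IHk] h le_h lt_h /=.
  by rewrite mul1r IH // ltnW.
rewrite exprS -mulrA.
have [||h' /andP[hh' ?]|c [_ ->]] := @zstar_step h (size kap) (zn (size kap) ^+ k * mon kap).
- by [].
- exact: leq_trans le_h (ltnW lt_h).
- by apply: IHk => //; exact: leq_trans le_h (ltnW hh').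
by rewrite (IHk h) // mulr0 scaler0 add0r gtn_eqF // mulr0 scale0r.
Qed.

(** The q-oscillator rule, from the recursion $c_{k+1} = q^2 c_k + 1 - q^2$ with $c_0 = 0$. The
    truncated [k.-1] is harmless at 0, where the coefficient vanishes. *)
Lemma zstar_zX kap k : (size kap < n * m)%N ->
  fstar (zn (size kap)) * (zn (size kap) ^+ k * mon kap)
  = (1 - qC ^+ (2 * k)) *: (zn (size kap) ^+ k.-1 * mon kap).
Proof.
move=> lt_p; elim: k => [|k IH].
  by rewrite muln0 expr0 subrr scale0r mul1r mon_zstar // leqnn.
rewrite exprS -mulrA.
have [//|//|h' /andP[hh' ?]|c [-> // ->]] :=
    @zstar_step (size kap) (size kap) (zn (size kap) ^+ k * mon kap).
  by apply: (@mon_zstar (k :: kap)); rewrite hh'.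
rewrite IH eqxx mulr1 funAr scalerA mulrA -exprS /=.
case: k {IH} => [|k] /=.
  by rewrite muln0 subrr mulr0 scale0r add0r.
by rewrite -scalerDl; congr (_ *: _); rewrite [(2 * k.+2)%N]mulnS exprD; ring.
Qed.

Lemma fstarX (x : Fun) k : fstar (x ^+ k) = fstar x ^+ k.
Proof.
elim: k => [|k IH]; first by rewrite !expr0; exact: star1.
by rewrite exprS fstarM IH exprSr.
Qed.

Lemma zstarX_zX kap k : (size kap < n * m)%N ->
  fstar (zn (size kap)) ^+ k * (zn (size kap) ^+ k * mon kap)
  = (\prod_(j < k) (1 - qC ^+ (2 * j.+1))) *: mon kap.
Proof.
move=> lt_p; elim: k => [|k IH]; first by rewrite big_ord0 scale1r !mul1r.
by rewrite exprSr -mulrA zstar_zX // funAr IH scalerA big_ord_recr /= mulrC.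
Qed.

(** The product of the q-Pochhammer symbols $(q^2;q^2)_k$ over the exponents k. *)
Fixpoint mon_norm (kap : seq nat) : C :=
  if kap is k :: kap' then
    (\prod_(j < k) (1 - qC ^+ (2 * j.+1))) * mon_norm kap'
  else 1.

Lemma mon_norm_gt0 kap : 0 < mon_norm kap.
Proof.
elim: kap => [|k kap IH] //=; apply: mulr_gt0 => //.
apply: prodr_gt0 => j _; rewrite subr_gt0 exprn_ilt1 //.
  by rewrite ler0c ltW.
by rewrite ltcR.
Qed.

Lemma mon_orth kap kap' : (size kap <= n * m)%N -> size kap = size kap' ->
  fstar (mon kap) * mon kap' = ((kap == kap')%:R * mon_norm kap) *: f0.
Proof.
elim: kap kap' => [|k kap IH] [|k' kap'] //=.
  by rewrite fstar_f0 f0f0 mulr1 scale1r.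
move=> lt_p [eq_sz].
(* A surplus adjoint of the leading generator remains and kills the monomial in smaller generators.
   The lists are quantified afresh to allow swapping them, the opposite inequality following by
   taking adjoints. *)
have lt0 : forall k k' kap kap', (size kap < n * m)%N -> size kap = size kap' -> (k' < k)%N ->
    fstar (mon (k :: kap)) * mon (k' :: kap') = 0.
  move=> {IH eq_sz lt_p k k' kap kap'} k k' kap kap' lt_p eq_sz lt_k /=.
  rewrite fstarM fstarX -mulrA eq_sz -(subnK lt_k) exprD exprS -!mulrA.
  by rewrite zstarX_zX -?eq_sz // funAr mon_zstar ?eq_sz ?leqnn -?eq_sz // scaler0 !mulr0.
have [lt_k|lt_k|<-] := ltngtP k k'.
- rewrite -[LHS]fstarK fstarM fstarK.
  have := lt0 k' k kap' kap _ (esym eq_sz) lt_k => /= ->; rewrite -?eq_sz //.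
  by rewrite fstar0 eqseq_cons (ltn_eqF lt_k) mul0r scale0r.
- have := lt0 k k' kap kap' lt_p eq_sz lt_k => /= ->.
  by rewrite eqseq_cons (gtn_eqF lt_k) mul0r scale0r.
rewrite fstarM fstarX -mulrA eq_sz zstarX_zX -?eq_sz // funAr IH ?(ltnW lt_p) //.
by rewrite scalerA eqseq_cons eqxx mulrCA.
Qed.

(** * Ordered monomials span [HU] *)

Definition mon_span (P : pred (seq nat)) (x : Fun) :=
  exists2 l : seq (C * seq nat),
    all (fun c => P c.2) l & x = \sum_(c <- l) c.1 *: mon c.2.

Lemma mon_span_mon (P : pred (seq nat)) kap : P kap -> mon_span P (mon kap).
Proof.
by move=> Pk; exists [:: (1, kap)]; rewrite /= ?Pk // big_seq1 scale1r.
Qed.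

Lemma mon_span0 P : mon_span P 0.
Proof. by exists [::]; rewrite ?big_nil. Qed.

Lemma mon_spanD P x y : mon_span P x -> mon_span P y -> mon_span P (x + y).
Proof.
move=> [l Pl ->] [l' Pl' ->]; exists (l ++ l'); first by rewrite all_cat Pl.
by rewrite big_cat.
Qed.

Lemma mon_spanZ P c x : mon_span P x -> mon_span P (c *: x).
Proof.
move=> [l Pl ->]; exists [seq (c * d.1, d.2) | d <- l]; first by rewrite all_map.
by rewrite big_map scaler_sumr; apply: eq_bigr => d _; rewrite scalerA.
Qed.

Lemma mon_span_mul (P Q : pred (seq nat)) (y : Fun) :
  (forall kap, P kap -> mon_span Q (y * mon kap)) ->
  forall x, mon_span P x -> mon_span Q (y * x).
Proof.
move=> PQ _ [l + ->]; elim: l => [|c l IH] /=.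
  by rewrite big_nil mulr0 => _; exact: mon_span0.
move=> /andP[Pc /IH ?]; rewrite big_cons mulrDr funAr; apply: mon_spanD => //.
exact/mon_spanZ/PQ.
Qed.

Lemma mon_span_sub (P Q : pred (seq nat)) x :
  subpred P Q -> mon_span P x -> mon_span Q x.
Proof. by move=> PQ [l Pl ->]; exists l => //; apply: sub_all Pl => c; exact: PQ. Qed.

Definition sized p : pred (seq nat) := fun kap => size kap == p.
(* Filtration by the exponent of the largest generator, for the straightening. *)
Definition sized_le p k : pred (seq nat) :=
  fun kap => (size kap == p.+1) && (head 0%N kap <= k)%N.

(** Outer induction on the number of generators. The largest one only raises its exponent
    ([lift_span]); a smaller one is straightened past it ([step]). *)
Lemma mon_span_z p h x : (h < p)%N -> (p <= n * m)%N ->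
  mon_span (sized p) x -> mon_span (sized p) (zn h * x).
Proof.
elim: p h x => // p IH h x le_h lt_p.
have lift_span k x' y : mon_span (sized_le p k) x' -> y = zn p * x' ->
    mon_span (sized_le p k.+1) y.
  move=> Sx ->; apply: mon_span_mul Sx => -[|j kap] //= /andP[/eqP[sz] le_j].
  rewrite mulrA sz -exprS -sz.
  by apply: (@mon_span_mon _ (j.+1 :: kap)); rewrite /sized_le /= sz eqxx.
(* Strong induction on the exponent of the largest generator; at exponent 0 the outer induction
   applies. *)
have step k : forall h x, (h < p)%N -> mon_span (sized_le p k) x ->
    mon_span (sized_le p k) (zn h * x).
  elim/ltn_ind: k => k IHk {le_h x}h x lt_h.
  apply: mon_span_mul => -[|[|j] kap] //= /andP[/eqP[sz] le_j].
    rewrite mul1r; have : mon_span (sized p) (zn h * mon kap).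
      by apply: IH (ltnW lt_p) _ => //; apply: mon_span_mon; rewrite /sized sz.
    move=> Sx; rewrite -[_ * _]mul1r; apply: mon_span_mul Sx => kap' /eqP sz'.
    have -> : 1 * mon kap' = mon (0%N :: kap') by [].
    by apply: mon_span_mon; rewrite /sized_le /= sz' eqxx.
  have Sj : mon_span (sized_le p j) (mon (j :: kap)).
    by apply: mon_span_mon; rewrite /sized_le /= sz eqxx /=.
  have [c [c' [u [v [lt_u lt_v zz]]]]] := zn_straighten lt_h lt_p.
  rewrite sz exprS -mulrA mulrA zz mulrDl !funAl -!mulrA.
  have -> : zn p ^+ j * mon kap = mon (j :: kap) by rewrite /= sz.
  have le_sub : subpred (sized_le p j.+1) (sized_le p k).
    by move=> kap' /andP[szk le_h]; rewrite /sized_le szk (leq_trans le_h).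
  have le_sub' : subpred (sized_le p j) (sized_le p k).
    move=> kap' /andP[szk le_h].
    by rewrite /sized_le szk (leq_trans le_h (ltnW le_j)).
  apply: mon_spanD; apply: mon_spanZ.
    apply: mon_span_sub le_sub _; apply: lift_span (erefl _).
    exact: IHk.
  (* The correction has one factor [zn p] fewer and two factors before [p], so the induction
     hypothesis at [j] is used twice. *)
  by apply: mon_span_sub le_sub' _; apply: (IHk j) => //; exact: (IHk j).
apply: mon_span_mul => -[|k kap] // /eqP[sz].
have Sk : mon_span (sized_le p k) (mon (k :: kap)).
  by apply: mon_span_mon; rewrite /sized_le /= sz eqxx /=.
have sub j : subpred (sized_le p j) (sized p.+1) by move=> ? /andP[].
move: le_h; rewrite ltnS leq_eqVlt => /orP[/eqP ->|lt_h].
  exact: mon_span_sub (@sub k.+1) (lift_span _ _ _ Sk erefl).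
exact: mon_span_sub (@sub k) (step _ _ _ lt_h Sk).
Qed.

Lemma HU_span x : HU x -> mon_span (sized (n * m)) x.
Proof.
move=> [psi Cpsi ->] {x}.
have : mon_span (sized (n * m)) f0.
  suff -> : f0 = mon (nseq (n * m) 0%N).
    by apply: mon_span_mon; rewrite /sized size_nseq.
  by elim: (n * m)%N => [|p IH] //=; rewrite mul1r.
move: f0; elim: Cpsi => {psi} [a al|||c|].
- by move=> x; rewrite -znE; apply: mon_span_z; rewrite ?idx_lt.
- by move=> x; rewrite mul1r.
- by move=> f g _ IHf _ IHg x Sx; rewrite mulrDl; apply: mon_spanD; auto.
- by move=> f _ IHf x Sx; rewrite funAl; apply: mon_spanZ; auto.
- by move=> f g _ IHf _ IHg x Sx; rewrite -mulrA; auto.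
Qed.

(** Up to normalization, the matrix units of the monomial basis: each [mon] ends in [f0]. *)
Definition mon2 (u : seq nat * seq nat) : Fun := mon u.1 * fstar (mon u.2).

(** Because f0 is a self-adjoint idempotent, a f0 b is a f0 times the adjoint of [fstar b * f0], and
    [HU_span] expands both. Equal pairs are merged so that diagonal terms can be isolated later. *)
Lemma DU_mon2 f : DU f -> exists (U : seq (seq nat * seq nat)) (G : _ -> C),
  [/\ uniq U, forall u, u \in U -> size u.1 = (n * m)%N /\ size u.2 = (n * m)%N
    & f = \sum_(u <- U) G u *: mon2 u].
Proof.
move=> [s ->].
have [l szl ->] : exists2 l : seq (C * (seq nat * seq nat)),
    all (fun c => sized (n * m) c.2.1 && sized (n * m) c.2.2) l
    & \sum_(p <- s) p.1 * f0 * p.2 = \sum_(c <- l) c.1 *: mon2 c.2.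
  elim: s => [|[a b] s [l szl lE]]; first by exists [::]; rewrite ?big_nil.
  have [la sza aE] := HU_span (HU_mulf0 a).
  have [lb szb bE] := HU_span (HU_mulf0 (fstar b)).
  exists ([seq (c.1 * d.1^*, (c.2, d.2)) | c <- la, d <- lb] ++ l).
    rewrite all_cat szl andbT; apply/allP => _ /allpairsP[[c d] [/= cla dlb ->]] /=.
    by rewrite (allP sza) ?(allP szb).
  rewrite big_cons big_cat /= lE; congr (_ + _).
  rewrite big_allpairs_dep -f0f0 mulrA -mulrA aE -[f0 * b]fstarK fstarM fstar_f0 bE.
  rewrite fstar_sum mulr_suml; apply: eq_bigr => c _.
  rewrite mulr_sumr; apply: eq_bigr => d _.
  by rewrite fstarZ funAl funAr scalerA.
exists (undup (map snd l)), (fun u => \sum_(c <- l | c.2 == u) c.1); split.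
- exact: undup_uniq.
- move=> u; rewrite mem_undup => /mapP[c cl ->].
  by have /andP[/eqP ? /eqP ?] := allP szl c cl.
under [RHS]eq_bigr do rewrite scaler_suml big_mkcond.
rewrite exchange_big /= big_seq [RHS]big_seq; apply: eq_bigr => c cl.
rewrite (bigD1_seq c.2) ?undup_uniq ?mem_undup ?map_f //= eqxx big1 ?addr0 //.
by move=> u; rewrite eq_sym => /negPf ->.
Qed.

(** * Eigenvalues of [rho] and positivity of the integral *)

Section Positivity.
Variable act : Uq q (m + n) -> Fun -> Fun.
Hypotheses (act_cov : covariant act) (act_gen : fun_action act).
Local Notation uK := (@uK R q (m + n)).
Local Notation uKinv := (@uKinv R q (m + n)).
Local Notation rho := (exp_hrho q (m + n)).

Let qC_gt0 : 0 < qC. Proof. by rewrite ltcR. Qed.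

(** The eigenvalue is one of $1$, $q$, $q^{-1}$, $q^2$. *)
Lemma act_uK_z j a al : exists2 c : C, 0 < c & act (uK j) (fz a al) = c *: fz a al.
Proof.
have [lt_j|gt_j|eq_j] := ltngtP j.+1 n.
- have [-> _ _ _ _] := act_low act_gen a al lt_j; eexists; last by [].
  by do ![case: ifP => _]; rewrite ?invr_gt0.
- have [||-> _ _ _ _] := @act_high _ _ _ _ _ act_gen j (j.+1 - n)%N a al.
  + by rewrite subn_gt0.
  + by rewrite subnKC // ltnW.
  eexists; last by [].
  by do ![case: ifP => _]; rewrite ?invr_gt0.
have a_lt : (n.-1 < n)%N by rewrite prednK.
have al_lt : (m.-1 < m)%N by rewrite prednK.
have [-> _ _] := act_mid act_gen a al (a' := Ordinal a_lt)
  (al' := Ordinal al_lt) eq_j (prednK n_gt0) (prednK m_gt0).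
eexists; last by [].
by do ![case: ifP => _]; rewrite ?exprn_gt0.
Qed.

Lemma act_rho_z a al : exists2 c : C, 0 < c & act rho (fz a al) = c *: fz a al.
Proof.
apply: (act_rho_ind (q := q) (act := act)
  (P := fun u => exists2 c : C, 0 < c & u (fz a al) = c *: fz a al)).
- move=> u v [c c_gt0 uE] [d d_gt0 vE]; exists (c * d); first exact: mulr_gt0.
  by rewrite act_mul // vE actZ // uE scalerA mulrC.
- by exists 1; rewrite // act_unit // scale1r.
- move=> j; have [c c_gt0 cE] := act_uK_z j a al.
  exists c^-1; first by rewrite invr_gt0.
  rewrite -[in RHS](act_uKinv_uK act_cov j (fz a al)) cE actZ // scalerA.
  by rewrite mulVf ?scale1r // gt_eqF.
Qed.

Lemma act_rho_mon kap : exists c : C, 0 < c /\ act rho (mon kap) = c *: mon kap.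
Proof.
elim: kap => [|k kap [c [c_gt0 cE]]] /=.
  by exists 1; rewrite scale1r act_rho_f0.
have [d d_gt0 dE] : exists2 d : C, 0 < d
    & act rho (zn (size kap)) = d *: zn (size kap) by exact: act_rho_z.
elim: k => [|k [e [e_gt0 eE]]]; first by exists c; rewrite mul1r.
exists (d * e); split; first exact: mulr_gt0.
by rewrite exprS -mulrA act_rhoM // dE eE funAl funAr scalerA.
Qed.

Lemma integral_sum (I : eqType) (s : seq I) (F : I -> Fun) :
  {in s, forall i, DU (F i)} ->
  DU (\sum_(i <- s) F i) /\
  integral act (\sum_(i <- s) F i) = \sum_(i <- s) integral act (F i).
Proof.
elim: s => [|i s IH] DF.
  rewrite !big_nil; have := integralE m_gt0 n_gt0 act_cov act_gen [::].
  by rewrite !big_nil => ->; split=> //; exists [::]; rewrite big_nil.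
have [|Ds Is] := IH; first by move=> j js; apply: DF; rewrite inE js orbT.
have Di : DU (F i) by apply: DF; rewrite inE eqxx.
have := integral_linear m_gt0 n_gt0 act_cov act_gen 1 Di Ds.
by rewrite !big_cons scale1r mul1r Is.
Qed.

Lemma DU_mulf0 x y : DU (x * f0 * y).
Proof. by exists [:: (x, y)]; rewrite big_seq1. Qed.

Lemma integral_mulf0 x y : integral act (x * f0 * y) = vac (y * act rho x).
Proof.
have := integralE m_gt0 n_gt0 act_cov act_gen [:: (x, y)].
by rewrite !big_seq1.
Qed.

Lemma DU_Z c x : DU x -> DU (c *: x).
Proof.
move=> Dx; have D0 : DU 0 by exists [::]; rewrite big_nil.
by have [] := integral_linear m_gt0 n_gt0 act_cov act_gen c Dx D0; rewrite addr0.
Qed.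

Lemma integralZ c x : DU x -> integral act (c *: x) = c * integral act x.
Proof.
move=> Dx; have D0 : DU 0 by exists [::]; rewrite big_nil.
have [_] := integral_linear m_gt0 n_gt0 act_cov act_gen c Dx D0.
rewrite addr0 => ->; have := integralE m_gt0 n_gt0 act_cov act_gen [::].
by rewrite !big_nil => ->; rewrite addr0.
Qed.

Lemma mon_f0 kap : mon kap * f0 = mon kap.
Proof.
by elim: kap => [|k kap IH] /=; [exact: f0f0|rewrite -mulrA IH].
Qed.

(** In the expansion of g over [mon2], the integral is diagonal with positive weights up to the
    factor [vac f0], so its vanishing forces every coefficient, hence g, to vanish. *)
Lemma integral_square g : DU g -> DU (fstar g * g)
  /\ 0 <= integral act (fstar g * g)
  /\ (integral act (fstar g * g) = 0 -> g = 0).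
Proof.
move=> /DU_mon2[U [G [U_uniq szU gE]]].
have [r rE] := choice act_rho_mon.
have mon2E u v : u \in U -> v \in U -> fstar (mon2 u) * mon2 v
    = ((u.1 == v.1)%:R * mon_norm u.1) *: (mon u.2 * f0 * fstar (mon v.2)).
  move=> /szU[u1 u2] /szU[v1 v2]; rewrite /mon2 fstarM fstarK mulrA.
  rewrite -(mulrA _ _ (mon v.1)) mon_orth ?u1 ?v1 // funAr funAl.
  by [].
have squareE : fstar g * g = \sum_(u <- U) \sum_(v <- U)
    ((G u)^* * G v * ((u.1 == v.1)%:R * mon_norm u.1))
      *: (mon u.2 * f0 * fstar (mon v.2)).
  rewrite gE fstar_sum mulr_suml big_seq [RHS]big_seq; apply: eq_bigr => u uU.
  rewrite mulr_sumr big_seq [RHS]big_seq; apply: eq_bigr => v vU.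
  by rewrite fstarZ funAl funAr mon2E // !scalerA mulrA.
have Dterm c (u v : seq nat) : DU (c *: (mon u * f0 * fstar (mon v))).
  exact/DU_Z/DU_mulf0.
have Dsum u : DU (\sum_(v <- U) ((G u)^* * G v
    * ((u.1 == v.1)%:R * mon_norm u.1)) *: (mon u.2 * f0 * fstar (mon v.2))).
  by case: (integral_sum (s := U) (F := fun v => ((G u)^* * G v
    * ((u.1 == v.1)%:R * mon_norm u.1)) *: (mon u.2 * f0 * fstar (mon v.2)))).
have [Dsq Isq] := integral_sum (s := U) (fun u _ => Dsum u).
split; first by rewrite squareE.
have IE : integral act (fstar g * g) = \sum_(u <- U)
    `|G u| ^+ 2 * (mon_norm u.1 * (r u.2 * mon_norm u.2)) * vac f0.
  rewrite squareE Isq big_seq [RHS]big_seq; apply: eq_bigr => u uU.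
  have [u1 u2] := szU u uU.
  have [_ ->] := integral_sum (s := U) (fun v _ => Dterm
    ((G u)^* * G v * ((u.1 == v.1)%:R * mon_norm u.1)) u.2 v.2).
  (* The product of two [mon2] forces equal first components and the functional equal second ones,
     so only v = u contributes. *)
  rewrite (bigD1_seq u) //= [X in _ + X]big_seq_cond big1 ?addr0.
    rewrite integralZ; last exact: DU_mulf0.
    rewrite integral_mulf0 (rE _).2 funAr vacZ mon_orth ?u2 // vacZ !eqxx.
    by rewrite normCK !mul1r; ring.
  move=> v /andP[/szU[v1 v2] uv]; rewrite integralZ; last exact: DU_mulf0.
  rewrite integral_mulf0 (rE _).2 funAr vacZ mon_orth ?u2 ?v2 // vacZ.
  have : (u.1 == v.1) && (v.2 == u.2) = false.
    apply: contraNF uv; case: u {uU u1 u2} => a b; case: v {v1 v2} => c d /=.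
    by move=> /andP[/eqP-> /eqP->].
  by case: (u.1 == v.1) => /= [->|_]; rewrite ?mul0r ?mulr0 ?mul0r.
have vac_f0_ge0 : 0 <= vac f0.
  have [f00|/eqP f00] := eqVneq f0 0; first by rewrite f00 vac0.
  by rewrite vac_f0.
have w_gt0 u : 0 < mon_norm u.1 * (r u.2 * mon_norm u.2) :> C.
  by rewrite !mulr_gt0 ?mon_norm_gt0 ?(rE _).1.
have term_ge0 u : 0 <= `|G u| ^+ 2 * (mon_norm u.1 * (r u.2 * mon_norm u.2)) * vac f0.
  by apply: mulr_ge0 => //; apply: mulr_ge0; [exact: exprn_ge0|exact: ltW].
split; first by rewrite IE sumr_ge0.
(* If f0 were 0, every [mon2] and hence g would be 0; otherwise [vac f0] is 1. *)
have [f00 _|/eqP f00] := eqVneq f0 0.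
  rewrite gE big1 // => u _.
  by rewrite /mon2 -(mon_f0 u.1) f00 mulr0 mul0r scaler0.
move=> /eqP; rewrite IE psumr_eq0 // => /allP G0.
rewrite gE big_seq big1 // => u /G0; rewrite vac_f0 // mulr1 mulf_eq0.
rewrite (gt_eqF (w_gt0 u)) orbF expf_eq0 normr_eq0 /= => /eqP ->.
by rewrite scale0r.
Qed.

Lemma integral_positive f : nonnegative f -> f <> 0 -> 0 < integral act f.
Proof.
move=> [s sD ->] fn0.
have [_ ->] := integral_sum (F := fun g => fstar g * g)
  (fun g gs => (integral_square (sD g gs)).1).
have ge0 g : g \in s -> 0 <= integral act (fstar g * g).
  by move=> /sD/integral_square[_ []].
rewrite lt0r big_seq sumr_ge0 // andbT psumr_eq0 //.
apply/negP => /allP I0; apply: fn0; apply: big1_seq => g /= gs.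
have [_ [_ sq0]] := integral_square (sD g gs).
have /implyP/(_ gs)/eqP/sq0 -> := I0 g gs.
by rewrite mulr0.
Qed.

End Positivity.
End Fock.

Theorem theorem9p2 (R : realType) (q : R) (m n : nat)
    (q_gt0 : 0 < q) (q_lt1 : q < 1) (m_gt0 : (0 < m)%N) (n_gt0 : (0 < n)%N)
    (act : Uq q (m + n) -> Fun q m n -> Fun q m n)
    (act_cov : covariant act) (act_gen : fun_action act) :
  [/\ forall f, DU f ->
        finite_rank (@HU R q m n) (Theta f) /\
        exists! t : R[i], is_trace (@HU R q m n) (nu_operator act f) t,
      forall (c : R[i]) (f g : Fun q m n), DU f -> DU g ->
        integral act (c *: f + g) = c * integral act f + integral act g,
      forall (xi : Uq q (m + n)) (f : Fun q m n), DU f ->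
        integral act (act xi f) = counit xi * integral act f
    & forall f : Fun q m n, nonnegative f -> f <> 0 -> 0 < integral act f].
Proof.
split=> [f Df|c f g Df Dg|xi f Df|f].
- split; first exact: finite_rank_Theta.
  have [s ->] := Df; have nuP := is_trace_nu m_gt0 n_gt0 act_cov act_gen s.
  exists (\sum_(p <- s) vac (p.2 * act (exp_hrho q (m + n)) p.1)).
  by split=> [|t /nuP ->]; first exact/nuP.
- by have [] := integral_linear m_gt0 n_gt0 act_cov act_gen c Df Dg.
- by have [] := integral_invariant q_gt0 m_gt0 n_gt0 act_cov act_gen xi Df.
- exact: integral_positive.
Qed.
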